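(* Let $F:\mathcal{S}_n\to\mathbb{R}$ be uniformly elliptic, continuous and quasiconcave, and let $u,v\in C(B_1)$ be viscosity subsolutions of $F(D^2w)=0$ in $B_1\subset\mathbb{R}^n$. Then for every $\theta\in(0,1)$ the function $w=\theta u+(1-\theta)v$ is a viscosity subsolution of $F(D^2w)=0$ in $B_1$.
   Context: $\mathcal{S}_n$ is the space of real symmetric $n\times n$ matrices. $F$ is uniformly elliptic with constants $0<\lambda\le\Lambda$ if $\lambda\|N\|\leq F(M+N)-F(M)\leq\Lambda\|N\|$ for all $M,N\in\mathcal{S}_n$ with $N\geq0$, where $\|N\|=\sup_{|x|=1}|Nx|$. $F$ is quasiconcave if $F(\theta M_1+(1-\theta)M_2)\geq\min\{F(M_1),F(M_2)\}$ for all $M_1,M_2\in\mathcal{S}_n$, $\theta\in[0,1]$. A continuous $u$ is a viscosity subsolution of $F(D^2u)=0$ in $\Omega$ if whenever $\varphi\in C^2(\Omega)$ and $u-\varphi$ has a local maximum at $x_0\in\Omega$, then $F(D^2\varphi(x_0))\geq0$. *)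

(* Defs.v *)
From HB Require Import structures.
From mathcomp Require Import all_boot all_order all_algebra.
From mathcomp Require Import all_classical all_reals all_analysis.
Set Implicit Arguments. Unset Strict Implicit. Unset Printing Implicit Defensive.
Import Order.TTheory GRing.Theory Num.Theory.
Import numFieldNormedType.Exports.
Local Open Scope classical_set_scope.
Local Open Scope ring_scope.

Section Defs.
Variables (R : realType) (n : nat).

Definition enorm (x : 'rV[R]_n) : R := Num.sqrt (\sum_(i < n) x ord0 i ^+ 2).

Definition opnorm (N : 'M[R]_n) : R :=
  sup [set enorm (x *m N^T) | x in [set x : 'rV[R]_n | enorm x = 1]].

Definition symmx (M : 'M[R]_n) : Prop := M^T = M.

Definition psd (N : 'M[R]_n) : Prop := forall x : 'rV[R]_n, 0 <= (x *m N *m x^T) ord0 ord0.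

Definition unif_elliptic (F : 'M[R]_n -> R) (lam Lam : R) : Prop :=
  0 < lam /\ lam <= Lam /\
  forall M N : 'M[R]_n, symmx M -> symmx N -> psd N ->
    lam * opnorm N <= F (M + N) - F M /\ F (M + N) - F M <= Lam * opnorm N.

Definition quasiconcave (F : 'M[R]_n -> R) : Prop :=
  forall (M1 M2 : 'M[R]_n) (t : R), symmx M1 -> symmx M2 -> 0 <= t <= 1 ->
    Num.min (F M1) (F M2) <= F (t *: M1 + (1 - t) *: M2).

Definition B1 : set 'rV[R]_n := [set x | enorm x < 1].

Definition evec (i : 'I_n) : 'rV[R]_n := delta_mx ord0 i.
Definition partial (i : 'I_n) (f : 'rV[R]_n -> R) : 'rV[R]_n -> R :=
  fun x => derive f x (evec i).

Definition C2_on (Omega : set 'rV[R]_n) (f : 'rV[R]_n -> R) : Prop :=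
  forall x, Omega x ->
    {for x, continuous f} /\
    forall i : 'I_n, derivable f x (evec i) /\ {for x, continuous (partial i f)} /\
      forall j : 'I_n, derivable (partial i f) x (evec j) /\
        {for x, continuous (partial j (partial i f))}.

Definition hessian (f : 'rV[R]_n -> R) (x : 'rV[R]_n) : 'M[R]_n :=
  \matrix_(i, j) partial j (partial i f) x.

Definition visc_subsol (F : 'M[R]_n -> R) (Omega : set 'rV[R]_n)
    (u : 'rV[R]_n -> R) : Prop :=
  {within Omega, continuous u} /\
  forall (phi : 'rV[R]_n -> R) (x0 : 'rV[R]_n),
    C2_on Omega phi -> Omega x0 ->
    (\forall x \near x0, u x - phi x <= u x0 - phi x0) ->
    0 <= F (hessian phi x0).

End Defs.

(* Main.v *)
Require Import Defs.
From HB Require Import structures.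
From mathcomp Require Import all_boot all_order all_algebra.
From mathcomp Require Import all_classical all_reals all_analysis.
From mathcomp Require Import ring lra.
Set Implicit Arguments. Unset Strict Implicit. Unset Printing Implicit Defensive.
Import Order.TTheory GRing.Theory Num.Theory.
Import numFieldNormedType.Exports.
Local Open Scope classical_set_scope.
Local Open Scope ring_scope.

(* Since [F] is continuous, quasiconcave and elliptic, the superlevel set [0 <= F] is a closed
   convex set of symmetric matrices which is stable under adding positive semidefinite ones.
   If [F (hessian phi z) < 0] for a test function [phi], a hyperplane separates [hessian phi z]
   from it: there are a nonzero positive semidefinite [A] and a constant [c] such that
   [\tr (A *m hessian phi z) < c <= \tr (A *m M)] whenever [0 <= F M].  So [u] and [v] are
   viscosity subsolutions of the linear equation [\tr (A *m hessian w) = c], and it remains to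
   add subsolutions of linear equations with constant coefficients.

   Let [phi] touch [u + v] from above at [z], where [u] and [v] are subsolutions for [c1] and
   [c2], and suppose that [\tr (A *m hessian phi z) < c1 + c2].  In a small ball around [z], [u]
   and [v] lie below polynomials [hu] and [hv] which are close to [u] and [v] on the sphere and
   have constant [\tr (A *m hessian _)], slightly smaller than [c1] and [c2]: a continuous
   function is approximated by polynomials (expectations of a random walk, as for Bernstein
   polynomials), and the Dirichlet problem with polynomial data on a sphere is solved by a
   polynomial.  Then [hu + hv - phi - eta * |x - z|^2] violates the maximum principle. *)

(** * Positive semidefinite matrices *)

Section PositiveSemidefinite.
Context {R : realType} {n : nat}.
Implicit Types (A H : 'M[R]_n) (x y e : 'rV[R]_n).

Definition bilin A x y : R := (x *m A *m y^T) ord0 ord0.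

Lemma bilinC A x y : symmx A -> bilin A x y = bilin A y x.
Proof.
move=> As; have trE (M : 'M[R]_1) : M ord0 ord0 = M^T ord0 ord0 by rewrite mxE.
by rewrite /bilin trE !trmx_mul trmxK As mulmxA.
Qed.

Lemma bilin_delta A i j : bilin A (delta_mx ord0 i) (delta_mx ord0 j) = A i j.
Proof. by rewrite /bilin -rowE trmx_delta -colE !mxE. Qed.

Lemma bilin_subZ A x e (s : R) : symmx A ->
  bilin A (x - s *: e) (x - s *: e) =
  bilin A x x - 2 * s * bilin A e x + s ^+ 2 * bilin A e e.
Proof.
move=> As; have := bilinC x e As; rewrite /bilin.
rewrite [(x - _)^T]raddfB/= !(mulmxBl, mulmxBr) [(s *: e)^T]linearZ/= -!scalemxAl -!scalemxAr.
move: (x *m A *m x^T) (x *m A *m e^T) (e *m A *m x^T) (e *m A *m e^T) => a b c d.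
by rewrite !mxE => ->; ring.
Qed.

Lemma psd_diag_ge0 A i : psd A -> 0 <= A i i.
Proof. by move=> /(_ (delta_mx ord0 i)); rewrite -/(bilin _ _ _) bilin_delta. Qed.

Lemma psd_diag_eq0_row A i j : symmx A -> psd A -> A i i = 0 -> A i j = 0.
Proof.
move=> As Ap Aii; apply/eqP; apply: contraT => Aij.
have := Ap (delta_mx ord0 j - ((A j j + 1) / (2 * A i j)) *: delta_mx ord0 i).
rewrite -/(bilin _ _ _) bilin_subZ// !bilin_delta Aii mulr0 addr0.
have -> : A j j - 2 * ((A j j + 1) / (2 * A i j)) * A i j = -1 by field.
by rewrite lerNr oppr0 ler10.
Qed.

Lemma psd_diag_eq0 A : symmx A -> psd A -> (forall i, A i i = 0) -> A = 0.
Proof. by move=> As Ap A0; apply/matrixP => i j; rewrite mxE psd_diag_eq0_row. Qed.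

Lemma psd_trace_gt0 A : symmx A -> psd A -> A != 0 -> 0 < \tr A.
Proof.
move=> As Ap A0; rewrite lt_def sumr_ge0 ?andbT => [|i _]; last exact: psd_diag_ge0.
apply: contra A0 => /eqP/psumr_eq0P tr0; apply/eqP/psd_diag_eq0 => // i.
by apply: tr0 => // k _; exact: psd_diag_ge0.
Qed.

Lemma trace_gt0_dim A : 0 < \tr A -> (0 < n)%N.
Proof. by case: n A => // A; rewrite /mxtrace big_ord0 ltxx. Qed.

Lemma trace_rank1_mul x H : \tr (x^T *m x *m H) = bilin H x x.
Proof. by rewrite -mulmxA mxtrace_mulC trace_mx11. Qed.

Lemma symmx_rank1 x : symmx (x^T *m x).
Proof. by rewrite /symmx trmx_mul trmxK. Qed.

Lemma psd_rank1 x : psd (x^T *m x).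
Proof.
move=> y; have -> : y *m (x^T *m x) *m y^T = (x *m y^T)^T *m (x *m y^T).
  by rewrite trmx_mul trmxK !mulmxA.
by rewrite mxE sumr_ge0// => i _; rewrite mxE -expr2 sqr_ge0.
Qed.

Definition cholesky_step A k := A - (A k k)^-1 *: ((row k A)^T *m row k A).

Lemma cholesky_stepE A k i j :
  cholesky_step A k i j = A i j - (A k k)^-1 * (A k i * A k j).
Proof. by rewrite !mxE big_ord1 !mxE. Qed.

Lemma symmx_cholesky_step A k : symmx A -> symmx (cholesky_step A k).
Proof.
move=> As; apply/matrixP => i j; rewrite mxE !cholesky_stepE.
by rewrite [A k j * _]mulrC -{1}As mxE.
Qed.

Lemma psd_cholesky_step A k : symmx A -> psd A -> A k k != 0 -> psd (cholesky_step A k).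
Proof.
move=> As Ap Ak x; pose e : 'rV[R]_n := delta_mx ord0 k.
have := Ap (x - (bilin A e x / A k k) *: e).
rewrite -!/(bilin _ _ _) bilin_subZ// bilin_delta; congr (0 <= _).
have -> : bilin (cholesky_step A k) x x = bilin A x x - (A k k)^-1 * bilin A e x ^+ 2.
  rewrite /bilin/cholesky_step mulmxBr mulmxBl -scalemxAr -scalemxAl -rowE.
  have -> : x *m ((row k A)^T *m row k A) *m x^T = (row k A *m x^T)^T *m (row k A *m x^T).
    by rewrite trmx_mul trmxK !mulmxA.
  move: (x *m A *m x^T) (row k A *m x^T) => M N.
  by rewrite !mxE big_ord1 !mxE.
by field.
Qed.

(* A Cholesky step splits off a nonnegative multiple of a rank-one matrix and leaves fewer
   nonzero diagonal entries. *)
Lemma trace_mul_psd_nsd_le0 A H : symmx A -> psd A ->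
  (forall x, bilin H x x <= 0) -> \tr (A *m H) <= 0.
Proof.
move=> As Ap Hn; have [m] := ubnP #|[pred i | A i i != 0]|.
elim: m A As Ap => // m IH A As Ap Am.
have [/existsP[k Ak]|] := boolP [exists k, A k k != 0]; last first.
  rewrite negb_exists => /forallP A0; rewrite (@psd_diag_eq0 A)// ?mul0mx ?mxtrace0// => i.
  by apply/eqP/negPn.
have -> : A = cholesky_step A k + (A k k)^-1 *: ((row k A)^T *m row k A) by rewrite subrK.
rewrite mulmxDl mxtraceD -scalemxAl mxtraceZ trace_rank1_mul -[leRHS]addr0 lerD//; last first.
  by rewrite mulr_ge0_le0// ?invr_ge0 ?psd_diag_ge0.
apply: IH; [exact: symmx_cholesky_step|exact: psd_cholesky_step|].
rewrite -ltnS; apply: leq_trans Am; rewrite ltnS [leqRHS](cardD1 k) inE Ak add1n ltnS.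
apply/subset_leq_card/fintype.subsetP => i; rewrite !inE cholesky_stepE.
have [->|_] := eqVneq i k; first by rewrite mulKf// subrr eqxx.
apply: contra => /eqP Ai; have -> : A k i = A i k by rewrite -{1}As mxE.
by rewrite (psd_diag_eq0_row k As Ap Ai) Ai mul0r mulr0 subrr.
Qed.

End PositiveSemidefinite.

(** * Second-order calculus *)

Lemma near_eq_continuous_at (T U : topologicalType) (f g : T -> U) x :
  (\forall y \near x, f y = g y) -> {for x, continuous f} -> {for x, continuous g}.
Proof.
move=> fg fc; rewrite /prop_for /continuous_at -(nbhs_singleton fg).
exact: cvg_trans (near_eq_cvg fg) fc.
Qed.

Lemma within_open_continuous (T U : topologicalType) (Omega : set T) (f : T -> U) x :
  open Omega -> {within Omega, continuous f} -> Omega x -> {for x, continuous f}.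
Proof. by move=> Oo; rewrite continuous_open_subspace// => fc Ox; apply: fc; rewrite inE. Qed.

Lemma continuous_at_sum (K : numFieldType) (V : normedModType K) (T : topologicalType)
    (I : Type) (r : seq I) (f : I -> T -> V) (x : T) :
  (forall i, {for x, continuous (f i)}) -> {for x, continuous (\sum_(i <- r) f i)}.
Proof.
move=> fc; elim/big_ind: _ => [|g h|i _]; [|exact: continuousD|exact: fc].
exact: cst_continuous.
Qed.

Lemma is_derive_big_sum (R : realType) (V W : normedModType R) (I : Type) (r : seq I)
    (f : I -> V -> W) (df : I -> W) (x v : V) :
  (forall i, is_derive x v (f i) (df i)) ->
  is_derive x v (\sum_(i <- r) f i) (\sum_(i <- r) df i).
Proof.
move=> fD; elim/big_ind2: _ => [|g dg h dh gD hD|i _]; [|exact: is_deriveD|exact: fD].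
exact: is_derive_cst.
Qed.

Section DirectionalCalculus.
Context {R : realType} {V : normedModType R}.
Implicit Types (f : V -> R) (x u v : V) (p q s t : R).

Lemma continuous_line x v : continuous (fun t => x + t *: v).
Proof. by move=> t; apply: cvgD; [exact: cvg_cst|apply: cvgZr_tmp; exact: cvg_id]. Qed.

Lemma near_line x v (P : V -> Prop) :
  (\forall y \near x, P y) -> \forall t \near 0, P (x + t *: v).
Proof. by move=> Px; apply: continuous_line; rewrite scale0r addr0. Qed.

Lemma near_parallelogram x u v (P : V -> Prop) : (\forall y \near x, P y) ->
  exists2 s, 0 < s &
    forall p q, 0 <= p <= s -> 0 <= q <= s -> P (x + p *: u + q *: v).
Proof.
move=> /nbhs_normP[d /= d0 dP]; pose m := `|u| + `|v| + 1.
have m0 : 0 < m by rewrite ltr_wpDl ?addr_ge0.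
exists (d / 2 / m) => [|p q]; first by rewrite !divr_gt0.
rewrite !ler_pdivlMr// => /andP[p0 pm] /andP[q0 qm]; apply: dP.
rewrite /ball_/= -addrA opprD addNKr normrN (le_lt_trans (ler_normD _ _))//.
rewrite !normrZ !ger0_norm// [d]splitr.
have := mulr_ge0 p0 (normr_ge0 v); have := mulr_ge0 q0 (normr_ge0 u).
by move: pm qm; rewrite /m !mulrDr !mulr1; nra.
Qed.

Lemma is_derive_line f x v t : derivable f (x + t *: v) v ->
  is_derive t 1 (fun s => f (x + s *: v)) ('D_v f (x + t *: v)).
Proof.
move=> fd; have quotientE : (fun h : R => h^-1 *: (((fun s => f (x + s *: v)) \o shift t) (h *: 1)
   - f (x + t *: v))) =
   (fun h : R => h^-1 *: ((f \o shift (x + t *: v)) (h *: v) - f (x + t *: v))).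
  apply/funext => h /=; congr (_ *: (f _ - _)).
  by rewrite scalerDl [h *: 1]mulr1 addrCA.
by split; rewrite /derivable /derive quotientE.
Qed.

Lemma MVT_line f x v t :
  (forall r : R, 0 <= r <= 1 -> derivable f (x + (t * r) *: v) v) ->
  exists2 r, 0 < r < 1 & f (x + t *: v) - f x = t * 'D_v f (x + (t * r) *: v).
Proof.
move=> fd; pose g r := f (x + (t * r) *: v).
have gd (r : R) : 0 <= r <= 1 -> is_derive r 1 g ('D_v f (x + (t * r) *: v) * t).
  move=> r01; have tD : is_derive r 1 (t \*: @id R) t.
    by apply: is_derive_eq; rewrite -[t *: 1]/(t * 1) mulr1.
  apply: (@is_derive1_comp R (fun s => f (x + s *: v)) (t \*: @id R)) tD.
  by apply: is_derive_line; exact: fd.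
have [||r] := @MVT R g (fun r => 'D_v f (x + (t * r) *: v) * t) 0 1 ltr01.
- by move=> r /subset_itv_oo_cc; rewrite in_itv/= => /gd.
- by apply: derivable_within_continuous => r; rewrite in_itv/= => /gd[].
- rewrite in_itv/= => r01; rewrite /g mulr0 scale0r addr0 mulr1 subr0 mulr1 mulrC.
  by exists r.
Qed.

Lemma is_derive_gt0_near (g : R -> R) (c q : R) : is_derive c 1 g q -> 0 < q ->
  \forall t \near c, t != c -> 0 < (g t - g c) / (t - c).
Proof.
move=> [gd gE] q0.
have : \forall h \near 0^', 0 < h^-1 *: ((g \o shift c) (h *: 1) - g c).
  have : (h^-1 *: ((g \o shift c) (h *: 1) - g c) @[h --> 0^']) --> q by rewrite -gE.
  by move/cvgr_gt; apply.
rewrite near_withinE => /nbhs_normP[d /= d0 dP]; apply/nbhs_normP; exists d => //= t td tc.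
have := dP (t - c); rewrite /ball_/= sub0r normrN distrC subr_eq0 => /(_ td tc).
by rewrite -![_ *: _]/(_ * _) mulr1 subrK mulrC.
Qed.

Lemma derive2_local_max_le0 (g g' : R -> R) (c q : R) :
  (\forall t \near c, is_derive (t : R) 1 g (g' t)) -> is_derive c 1 g' q ->
  (\forall t \near c, g t <= g c) -> q <= 0.
Proof.
move=> gD g'D gmax; rewrite leNgt; apply/negP => q0.
have /nbhs_normP[d /= d0 dP] : \forall t \near c, [/\ is_derive (t : R) 1 g (g' t),
    g t <= g c & t != c -> 0 < (g' t - g' c) / (t - c)].
  by near=> t; split; near: t => //; exact: is_derive_gt0_near q0.
have near_c t : t \in `]c - d, c + d[%R -> ball_ Num.norm c d t.
  by rewrite in_itv /ball_/= distrC ltr_distl.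
have cI : c \in `]c - d, c + d[%R by rewrite in_itv/=; lra.
have g'c : g' c = 0.
  have cdd : c - d <= c + d by lra.
  have [||_ <-] := @derive1_at_max R g (c - d) (c + d) c cdd _ cI.
  - by move=> t /near_c/dP[[]].
  - by move=> t /near_c/dP[[]].
  - by have [[_ <-]] := dP _ (near_c c cI).
have ltI t : t \in `[c, c + d / 2]%R -> t \in `]c - d, c + d[%R.
  by rewrite !in_itv/=; lra.
have cd2 : c < c + d / 2 by lra.
have [||r rI] := @MVT R g g' c (c + d / 2) cd2.
- by move=> r /subset_itv_oo_cc/ltI/near_c/dP[].
- by apply: derivable_within_continuous => r /ltI/near_c/dP[[]].
have [_ _] := dP _ (near_c r (ltI r (subset_itv_oo_cc rI))).
rewrite in_itv/= in rI; have /andP[cr _] := rI.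
rewrite gt_eqF// g'c subr0 pmulr_lgt0 ?invr_gt0 ?subr_gt0// => /(_ isT) g'r incr.
have cdI : c + d / 2 \in `[c, c + d / 2]%R by rewrite in_itv/=; lra.
have [_ + _] := dP _ (near_c _ (ltI _ cdI)).
by rewrite -subr_le0 incr leNgt mulr_gt0//; lra.
Unshelve. all: end_near. Qed.

Lemma mixed_increment f x u v s : 0 < s ->
  (forall p q, 0 <= p <= s -> 0 <= q <= s ->
     derivable f (x + p *: u + q *: v) u /\
     derivable ('D_u f) (x + p *: u + q *: v) v) ->
  exists p q, [/\ 0 <= p <= s, 0 <= q <= s &
    f (x + s *: u + s *: v) - f (x + s *: u) - (f (x + s *: v) - f x) =
      s ^+ 2 * 'D_v ('D_u f) (x + p *: u + q *: v)].
Proof.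
move=> s0 fd; have sI : 0 <= s <= s by lra.
have zeroI : 0 <= (0 : R) <= s by lra.
pose g p := f (x + s *: v + p *: u) - f (x + p *: u).
pose g' p := 'D_u f (x + s *: v + p *: u) - 'D_u f (x + p *: u).
have gD p : 0 <= p <= s -> is_derive p 1 g (g' p).
  move=> p01; apply: is_deriveB; apply: is_derive_line.
    by rewrite addrAC; have [] := fd _ _ p01 sI.
  by have [+ _] := fd _ _ p01 zeroI; rewrite scale0r addr0.
have [||p pI] := @MVT R g g' 0 s s0.
- by move=> p /subset_itv_oo_cc; rewrite in_itv/= => /gD.
- by apply: derivable_within_continuous => p; rewrite in_itv/= => /gD[].
have {}pI : 0 <= p <= s by have := subset_itv_oo_cc pI; rewrite in_itv.
pose k q := 'D_u f (x + p *: u + q *: v).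
have kD q : 0 <= q <= s -> is_derive q 1 k ('D_v ('D_u f) (x + p *: u + q *: v)).
  by move=> q01; apply: is_derive_line; have [] := fd _ _ pI q01.
have [||q qI ek eg] := @MVT R k (fun q => 'D_v ('D_u f) (x + p *: u + q *: v)) 0 s s0.
- by move=> q /subset_itv_oo_cc; rewrite in_itv/= => /kD.
- by apply: derivable_within_continuous => q; rewrite in_itv/= => /kD[].
exists p, q; split => //; first by have := subset_itv_oo_cc qI; rewrite in_itv.
move: ek eg; rewrite /g /g' /k !scale0r !subr0 !addr0 => ek eg.
by rewrite [x + s *: u + _]addrAC eg [x + s *: v + _]addrAC ek -mulrA mulrC expr2.
Qed.

Lemma derive_swap f x u v :
  (\forall y \near x, derivable f y u /\ derivable ('D_u f) y v) ->
  (\forall y \near x, derivable f y v /\ derivable ('D_v f) y u) ->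
  {for x, continuous ('D_v ('D_u f))} -> {for x, continuous ('D_u ('D_v f))} ->
  'D_v ('D_u f) x = 'D_u ('D_v f) x.
Proof.
move=> fuv fvu cuv cvu; apply/eqP; rewrite -subr_eq0 -normr_le0.
apply/ler_addgt0Pr => e e0; rewrite add0r.
have e2 : 0 < e / 2 by rewrite divr_gt0.
have close_uv : \forall y \near x, `|'D_v ('D_u f) x - 'D_v ('D_u f) y| <= e / 2.
  by move: cuv => /cvgrPdist_le; apply.
have close_vu : \forall y \near x, `|'D_u ('D_v f) x - 'D_u ('D_v f) y| <= e / 2.
  by move: cvu => /cvgrPdist_le; apply.
have [s s0 sP] := near_parallelogram u v (filterI (filterI fuv fvu) (filterI close_uv close_vu)).
have [p q ps qs|p [q [ps qs Euv]]] := @mixed_increment f x u v s s0.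
  by have [[]] := sP p q ps qs.
have [p' q' p's q's|p' [q' [p's q's Evu]]] := @mixed_increment f x v u s s0.
  by rewrite addrAC; have [[]] := sP q' p' q's p's.
rewrite (addrAC x (p' *: v)) in Evu.
have mixedE : 'D_v ('D_u f) (x + p *: u + q *: v) = 'D_u ('D_v f) (x + q' *: u + p' *: v).
  have s2 : s ^+ 2 != 0 by rewrite expf_neq0// gt_eqF.
  apply: (mulfI s2); apply: etrans (esym Euv) (etrans _ Evu).
  rewrite (addrAC x (s *: v)).
  by move: (f (x + _ + _)) (f (x + _)) (f (x + _)) (f x) => b1 b2 b3 b4; ring.
have [_ [duv _]] := sP p q ps qs; have [_ [_ dvu]] := sP q' p' q's p's.
rewrite mixedE in duv; rewrite [leRHS]splitr.
apply: le_trans (ler_distD ('D_u ('D_v f) (x + q' *: u + p' *: v)) _ _) _.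
by rewrite distrC in dvu; exact: lerD duv dvu.
Qed.

End DirectionalCalculus.

Section Partials.
Context {R : realType} {n : nat}.
Implicit Types (f : 'rV[R]_n -> R) (x y z a : 'rV[R]_n).

Lemma norm_rV_leP z (c : R) : 0 <= c -> (`|z| <= c) <-> (forall j, `|z ord0 j| <= c).
Proof.
move=> c0; rewrite [`|z|]mx_normrE; split=> [/bigmax_leP[_ zc] j|zc].
  exact: (zc (ord0, j)).
by apply/bigmax_leP; split => // -[i j] _ /=; rewrite ord1.
Qed.

Lemma ler_norm_coord z j : `|z ord0 j| <= `|z|.
Proof. exact: (norm_rV_leP _ (normr_ge0 z)).1. Qed.

Lemma increment_partials f x z :
  (forall y, `|y - x| <= `|z| -> forall i, derivable f y (evec R i)) ->
  exists2 w : 'I_n -> 'rV[R]_n, (forall i, `|w i| <= `|z|) &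
    f (x + z) - f x = \sum_i z ord0 i * partial i f (x + w i).
Proof.
move=> fd; pose trunc k : 'rV[R]_n := \row_j (if (j < k)%N then z ord0 j else 0).
have truncS (i : 'I_n) : trunc i.+1 = trunc i + z ord0 i *: evec R i.
  apply/rowP => j; rewrite !mxE eqxx/= ltnS [j == i]/eq_op/=.
  by case: (ltngtP j i) => ji; rewrite ?mulr0 ?addr0// mulr1 add0r; congr (z _ _); apply/val_inj.
have small (i : 'I_n) s : `|s| <= `|z ord0 i| -> `|trunc i + s *: evec R i| <= `|z|.
  move=> sz; apply/norm_rV_leP => // j; rewrite !mxE eqxx/=.
  have [->|ji] := eqVneq j i; rewrite ?ltnn ?mulr1 ?mulr0 ?add0r ?addr0.
    by rewrite (le_trans sz)// ler_norm_coord.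
  by case: ifP => _; rewrite ?normr0// ler_norm_coord.
have step (i : 'I_n) : exists w, `|w| <= `|z| /\
    f (x + trunc i.+1) - f (x + trunc i) = z ord0 i * partial i f (x + w).
  have zr (r : R) : 0 <= r <= 1 -> `|z ord0 i * r| <= `|z ord0 i|.
    by move=> /andP[r0 r1]; rewrite normrM (ger0_norm r0) ler_piMr.
  have [r /zr/small zr_small|r r01 e] := @MVT_line R _ f (x + trunc i) (evec R i) (z ord0 i).
    by apply: fd; rewrite addrAC [x + _ - x]addrAC subrr add0r.
  exists (trunc i + (z ord0 i * r) *: evec R i); split.
    by apply/small/zr; move: r01 => /andP[/ltW-> /ltW->].
  by rewrite truncS !addrA.
have [w wP] := choice step; exists w => [i|]; first by case: (wP i).
have -> : z = trunc n by apply/rowP => j; rewrite mxE ltn_ord.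
have {2}-> : x = x + trunc 0%N.
  by rewrite -[LHS]addr0; congr (_ + _); apply/rowP => j; rewrite !mxE.
rewrite -(@telescope_sumr _ 0 n (fun k => f (x + trunc k)))// big_mkord.
by apply: eq_bigr => i _; rewrite (wP i).2 mxE ltn_ord.
Qed.

Lemma near_increment_partials f x (e : R) : 0 < e ->
  (\forall y \near x, forall i, derivable f y (evec R i)) ->
  (forall i, {for x, continuous (partial i f)}) ->
  \forall z \near (0 : 'rV[R]_n),
    `|f (x + z) - f x - \sum_i z ord0 i * partial i f x| <= n%:R * e * `|z|.
Proof.
move=> e0 fd fc.
have /nbhs_normP[d /= d0 dP] : \forall y \near x, (forall i, derivable f y (evec R i)) /\
    forall i, `|partial i f x - partial i f y| <= e.
  near=> y; split; near: y => //; apply: filter_forall => i.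
  by move: (fc i) => /cvgrPdist_le; apply.
apply/nbhs_normP; exists d => // z; rewrite /ball_/= sub0r normrN => zd.
have close w : `|w| <= `|z| -> ball_ Num.norm x d (x + w).
  by rewrite /ball_/= opprD addNKr normrN => /le_lt_trans; apply.
have [y yz|w wz ->] := @increment_partials f x z.
  by have [|] := dP y; first by rewrite -[y](subrK x) [_ + x]addrC; exact: close.
rewrite -sumrB (le_trans (ler_norm_sum _ _ _))//.
apply: (@le_trans _ _ (\sum_(i < n) `|z| * e)); last first.
  by rewrite sumr_const card_ord -[leLHS]mulr_natl mulrA mulrAC.
apply: ler_sum => i _; rewrite -mulrBr normrM.
apply: ler_pM => //; first exact: ler_norm_coord.
by rewrite distrC; have [_] := dP _ (close _ (wz i)).
Unshelve. all: end_near. Qed.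

Lemma is_derive_partials f x a :
  (\forall y \near x, forall i, derivable f y (evec R i)) ->
  (forall i, {for x, continuous (partial i f)}) ->
  is_derive x a f (\sum_i a ord0 i * partial i f x).
Proof.
move=> fd fc; set L := \sum_i _.
suff quotient_cvg : (h^-1 *: ((f \o shift x) (h *: a) - f x) @[h --> 0^']) --> L.
  by split; [apply/cvg_ex; eexists; exact: quotient_cvg|exact: cvg_lim quotient_cvg].
apply/cvgrPdist_le => e e0; pose m := n%:R * `|a| + 1.
have m0 : 0 < m by rewrite ltr_wpDl// mulr_ge0.
have /(near_line a) := near_increment_partials (divr_gt0 e0 m0) fd fc.
rewrite near_withinE; apply: filterS => h /=; rewrite add0r addrC => incr h0.
have -> : L = h^-1 * \sum_i (h *: a) ord0 i * partial i f x.
  rewrite mulr_sumr; apply: eq_bigr => i _; rewrite mxE.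
  by rewrite !mulrA mulVf// mul1r.
rewrite distrC -mulrBr normrM normfV ler_pdivrMl ?normr_gt0// addrC [in f (_ + _)]addrC.
apply: le_trans incr _; rewrite normrZ.
have -> : n%:R * (e / m) * (`|h| * `|a|) = `|h| * e * (n%:R * `|a| / m) by ring.
by rewrite ler_piMr ?ler_pdivrMr ?mul1r ?lerDl ?mulr_ge0 ?(ltW e0).
Qed.

Definition C2_at f x : Prop := {for x, continuous f} /\
  forall i : 'I_n, derivable f x (evec R i) /\ {for x, continuous (partial i f)} /\
    forall j : 'I_n, derivable (partial i f) x (evec R j) /\
      {for x, continuous (partial j (partial i f))}.

Lemma C2_at_continuous f x : C2_at f x -> {for x, continuous f}.
Proof. by case. Qed.

Lemma C2_at_derivable f x i : C2_at f x -> derivable f x (evec R i).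
Proof. by case=> _ /(_ i)[]. Qed.

Lemma C2_at_continuous_partial f x i : C2_at f x -> {for x, continuous (partial i f)}.
Proof. by case=> _ /(_ i)[_ []]. Qed.

Lemma C2_at_derivable_partial f x i j : C2_at f x -> derivable (partial i f) x (evec R j).
Proof. by case=> _ /(_ i)[_ [_ /(_ j)[]]]. Qed.

Lemma C2_at_continuous_partial2 f x i j :
  C2_at f x -> {for x, continuous (partial j (partial i f))}.
Proof. by case=> _ /(_ i)[_ [_ /(_ j)[]]]. Qed.

Lemma bilin_hessianE f x a : bilin (hessian f x) a a =
  \sum_i a ord0 i * (\sum_j a ord0 j * partial j (partial i f) x).
Proof.
rewrite /bilin mxE; under eq_bigr => j _ do rewrite !mxE mulr_suml.
rewrite exchange_big/=; apply: eq_bigr => i _; rewrite mulr_sumr.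
by apply: eq_bigr => j _; rewrite !mxE; ring.
Qed.

Lemma second_derivative_test f x a : (\forall y \near x, C2_at f y) ->
  (\forall y \near x, f y <= f x) -> bilin (hessian f x) a a <= 0.
Proof.
move=> f2 fmax; pose g' t := \sum_i a ord0 i * partial i f (x + t *: a).
have fD : \forall y \near x, is_derive y a f (\sum_i a ord0 i * partial i f y).
  apply: filterS (near_join f2) => y yf2; apply: is_derive_partials => [|i].
    by apply: filterS yf2 => w wf2 i; exact: C2_at_derivable.
  by apply: C2_at_continuous_partial; exact: nbhs_singleton yf2.
apply: (@derive2_local_max_le0 R (fun t => f (x + t *: a)) g' 0).
- apply: filterS (near_line a fD) => t [fd fdE].
  by rewrite /g' -fdE; exact: is_derive_line.
- have -> : g' = \sum_i (a ord0 i \*: (fun t => partial i f (x + t *: a))).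
    by apply/funext => t; rewrite fct_sumE.
  rewrite bilin_hessianE; apply: is_derive_sum => i; apply: is_deriveZ.
  have [pd pE] : is_derive x a (partial i f) (\sum_j a ord0 j * partial j (partial i f) x).
    apply: is_derive_partials => [|j].
      by apply: filterS f2 => y yf2 j; exact: C2_at_derivable_partial.
    by apply: C2_at_continuous_partial2; exact: nbhs_singleton f2.
  have := @is_derive_line R _ (partial i f) x a 0.
  by rewrite scale0r addr0 pE => /(_ pd).
- by apply: filterS (near_line a fmax) => t; rewrite scale0r addr0.
Qed.

Lemma hessian_sym f x : (\forall y \near x, C2_at f y) -> symmx (hessian f x).
Proof.
move=> f2; apply/matrixP => i j; rewrite !mxE.
have f2x : C2_at f x := nbhs_singleton f2.
apply: (@derive_swap R _ f x (evec R j) (evec R i)).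
- by apply: filterS f2 => y yf2; split; [exact: C2_at_derivable|exact: C2_at_derivable_partial].
- by apply: filterS f2 => y yf2; split; [exact: C2_at_derivable|exact: C2_at_derivable_partial].
- exact: C2_at_continuous_partial2 f2x.
- exact: C2_at_continuous_partial2 f2x.
Qed.

End Partials.

(** * Closest points and separation *)

Lemma convex_setP (R : numDomainType) (M : lmodType R) (K : set M) : convex_set K <->
  forall x y (t : R), K x -> K y -> 0 <= t <= 1 -> K (t *: x + (1 - t) *: y).
Proof.
split=> [Kc x y t Kx Ky /andP[t0 t1]|Kc x y t /set_mem Kx /set_mem Ky].
  by have := Kc x y (Itv01 t0 t1) (mem_set Kx) (mem_set Ky) => /set_mem.
by apply/mem_set/Kc => //; rewrite ge0 le1.
Qed.

Section ClosestPoint.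
Context {R : realType} {n : nat}.
Implicit Types (x y z : 'rV[R]_n) (K : set 'rV[R]_n) (c t : R).

Definition sqnorm x : R := \sum_i x ord0 i ^+ 2.
Definition dotrv x y : R := \sum_i x ord0 i * y ord0 i.
Definition sqdist z x : R := sqnorm (x - z).

(* [c] is the squared radius. *)
Definition cball z c : set 'rV[R]_n := [set x | sqdist z x <= c].

Lemma sqnorm_ge0 x : 0 <= sqnorm x.
Proof. by apply: sumr_ge0 => i _; exact: sqr_ge0. Qed.

Lemma sqnorm0 : sqnorm 0 = 0.
Proof. by apply: big1 => i _; rewrite mxE expr0n. Qed.

Lemma sqnorm_eq0 x : sqnorm x = 0 -> x = 0.
Proof.
move=> /psumr_eq0P x0; apply/rowP => i; rewrite mxE; apply/eqP.
by rewrite -sqrf_eq0 x0// => j _; exact: sqr_ge0.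
Qed.

Lemma sqnormD x y t : sqnorm (x + t *: y) = sqnorm x + 2 * t * dotrv x y + t ^+ 2 * sqnorm y.
Proof.
rewrite /sqnorm /dotrv !mulr_sumr -!big_split/=; apply: eq_bigr => i _.
by rewrite !mxE; ring.
Qed.

Lemma norm_le_sqnorm x : `|x| ^+ 2 <= sqnorm x.
Proof.
have [->|x0] := eqVneq x 0; first by rewrite normr0 expr0n sqnorm_ge0.
have [[k j] ->] : exists ij, `|x| = `|x ij.1 ij.2|.
  by apply: mx_norm_neq0; rewrite -[mx_norm x]/(`|x|) normr_eq0.
rewrite /= ord1 real_normK ?num_real// /sqnorm (bigD1 j)//= lerDl.
by apply: sumr_ge0 => i _; exact: sqr_ge0.
Qed.

Lemma sqdist_ge0 z x : 0 <= sqdist z x.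
Proof. exact: sqnorm_ge0. Qed.

Lemma sqdistxx z : sqdist z z = 0.
Proof. by rewrite /sqdist subrr sqnorm0. Qed.

Lemma continuous_sqdist z : continuous (sqdist z).
Proof.
pose coord (i : 'I_n) x := x ord0 i.
have -> : sqdist z = \sum_i (coord i - cst (z ord0 i)) ^+ 2.
  by apply/funext => y; rewrite fct_sumE; apply: eq_bigr => i _; rewrite !mxE.
move=> x; apply: continuous_at_sum => i.
have coordB : {for x, continuous (coord i - cst (z ord0 i))}.
  by apply: continuousB; [exact: coord_continuous|exact: cst_continuous].
exact: (continuousM coordB coordB).
Qed.

Lemma near_sqdist_lt z c x : sqdist z x < c -> \forall y \near x, sqdist z y < c.
Proof. by move=> xc; move: (@continuous_sqdist z x) => /cvgr_lt; apply. Qed.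

Lemma compact_cball z c : compact (cball z c).
Proof.
apply: bounded_closed_compact; last first.
  apply: (@preimage_closed _ _ (sqdist z) [set y | y <= c]).
    by move=> x _; exact: continuous_sqdist.
  exact: closed_le.
exists (`|z| + Num.sqrt c); split; first exact: num_real.
move=> m mz x xc; apply: le_trans (ltW mz).
rewrite -[x](subrK z) addrC (le_trans (ler_normD _ _))// lerD2l.
have c0 : 0 <= c by exact: le_trans (sqnorm_ge0 _) xc.
rewrite -(@ler_pXn2r _ 2)// ?nnegrE ?sqrtr_ge0// sqr_sqrtr//.
exact: le_trans (norm_le_sqnorm _) xc.
Qed.

Lemma cball_near z (P : 'rV[R]_n -> Prop) :
  (\forall x \near z, P x) -> exists2 c, 0 < c & forall x, cball z c x -> P x.
Proof.
move=> /nbhs_normP[d /= d0 dP]; exists ((d / 2) ^+ 2) => [|x xd].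
  by rewrite exprn_gt0// divr_gt0.
apply: dP; rewrite /ball_/= distrC; apply: (@le_lt_trans _ _ (d / 2)); last by lra.
rewrite -(@ler_pXn2r _ 2)// ?nnegrE//; last by lra.
exact: le_trans (norm_le_sqnorm _) xd.
Qed.

(* If the inner product were negative, the segment from [p] to [y] would enter the open ball
   of center [z] through [p]. *)
Lemma closest_point K z : closed K -> K !=set0 -> convex_set K ->
  exists2 p, K p & forall y, K y -> 0 <= dotrv (p - z) (y - p).
Proof.
move=> Kcl [y0 Ky0] /convex_setP Kconv; pose S := cball z (sqdist z y0) `&` K.
have S0 : S !=set0 by exists y0; split=> //; exact: lexx.
have [|p /set_mem[pz Kp] pmin] :=
    compact_EVT_min S0 (compact_closedI (@compact_cball z _) Kcl) (f := sqdist z).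
  by apply: continuous_subspaceT; exact: continuous_sqdist.
exists p => // y Ky.
have closest x : K x -> sqdist z p <= sqdist z x.
  move=> Kx; have [xy0|/ltW xy0] := leP (sqdist z x) (sqdist z y0).
    by apply/pmin/mem_set.
  exact: le_trans pz xy0.
set D := dotrv _ _; rewrite leNgt; apply/negP => D0; pose s := sqnorm (y - p).
have s0 : 0 <= s by exact: sqnorm_ge0.
have sD : 0 < s - D by lra.
pose t := - D / (s - D).
have t0 : 0 < t by rewrite divr_gt0// oppr_gt0.
have t1 : t <= 1 by rewrite ler_pdivrMr// mul1r lerDr.
have := closest _ (Kconv _ _ t Ky Kp _); rewrite t1 (ltW t0) /sqdist => /(_ isT).
have -> : t *: y + (1 - t) *: p - z = p - z + t *: (y - p).
  by apply/rowP => i; rewrite !mxE; ring.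
rewrite sqnormD -/D -/s -addrA lerDl.
have -> : 2 * t * D + t ^+ 2 * s = t * (2 * D + t * s) by ring.
rewrite pmulr_rge0// => incr.
have tE : t * (s - D) = - D by rewrite /t divfK// gt_eqF.
by have := mulr_gt0 t0 sD; nra.
Qed.

End ClosestPoint.

Section Separation.
Context {R : realType}.

Lemma dotrv_mxvec m n (A B : 'M[R]_(m, n)) : dotrv (mxvec A) (mxvec B) = \tr (A^T *m B).
Proof.
rewrite /dotrv (reindex _ (curry_mxvec_bij m n))/= /mxtrace.
under [RHS]eq_bigr => j _ do rewrite mxE.
rewrite exchange_big pair_big/=; apply: eq_bigr => -[i j] _ /=.
by rewrite !mxvecE mxE.
Qed.

Lemma continuous_vec_mx m n : continuous (@vec_mx R m n).
Proof.
move=> v s /nbhs_ballP[e e0 es]; apply/nbhs_ballP; exists e => // w [_ vw].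
by apply: es; split => // i j; rewrite !mxE; exact: vw.
Qed.

Lemma closest_point_mx m n (K : set 'M[R]_(m, n)) M0 :
  closed K -> K !=set0 -> convex_set K ->
  exists2 P, K P & forall M, K M -> 0 <= \tr ((P - M0)^T *m (M - P)).
Proof.
move=> Kcl [M KM] /convex_setP Kconv.
have [|||p Kp pmin] := @closest_point R _ (vec_mx @^-1` K) (mxvec M0).
- by apply: preimage_closed => // v _; exact: continuous_vec_mx.
- by exists (mxvec M); rewrite /= mxvecK.
- apply/convex_setP => x y t Kx Ky t01.
  by rewrite /= linearD/= !linearZ/=; exact: Kconv.
exists (vec_mx p) => // N KN; rewrite -dotrv_mxvec !raddfB/= vec_mxK.
by apply: pmin; rewrite /= mxvecK.
Qed.

Lemma trace_gram_gt0 m n (A : 'M[R]_(m, n)) : A != 0 -> 0 < \tr (A^T *m A).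
Proof.
rewrite -dotrv_mxvec => A0; have -> : dotrv (mxvec A) (mxvec A) = sqnorm (mxvec A).
  by apply: eq_bigr => i _; rewrite expr2.
rewrite lt_def sqnorm_ge0 andbT; apply: contra A0 => /eqP/sqnorm_eq0 vecA0.
by rewrite -(mxvecK A) vecA0 linear0.
Qed.

(* The normal [A] is the difference between [M0] and its closest point in [K]. *)
Lemma psd_separation n (K : set 'M[R]_n) M0 : (0 < n)%N ->
  closed K -> K `<=` @symmx R n -> convex_set K ->
  (forall M N, K M -> symmx N -> psd N -> K (M + N)) ->
  symmx M0 -> ~ K M0 ->
  exists A (c : R), [/\ symmx A, psd A, 0 < \tr A,
    forall M, K M -> c <= \tr (A *m M) & \tr (A *m M0) < c].
Proof.
move=> n0 Kcl Ks Kconv Kup M0s KM0.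
have [Kne|Kempty] := pselect (K !=set0); last first.
  exists 1%:M, (\tr M0 + 1); split; rewrite ?mul1mx ?mxtrace1 ?ltr0n ?ltrDl//.
  - exact: trmx1.
  - by move=> x; rewrite mulmx1 mxE sumr_ge0// => i _; rewrite mxE -expr2 sqr_ge0.
  - by move=> M KM; case: Kempty; exists M.
have [P KP Pmin] := closest_point_mx M0 Kcl Kne Kconv; pose A := P - M0.
have As : symmx A by rewrite /symmx /A raddfB/= (Ks _ KP) M0s.
have A0 : A != 0 by rewrite subr_eq0; apply/eqP => PM0; apply: KM0; rewrite -PM0.
have Ap : psd A.
  move=> x; have := Pmin _ (Kup _ _ KP (symmx_rank1 x) (psd_rank1 x)).
  by rewrite addrAC subrr add0r -/A As mxtrace_mulC trace_rank1_mul.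
exists A, (\tr (A *m P)); split => //.
- exact: psd_trace_gt0.
- by move=> M /Pmin; rewrite -/A As mulmxBr raddfB/= subr_ge0.
- by rewrite -subr_gt0 -raddfB/= -mulmxBr -/A -{1}As trace_gram_gt0.
Qed.

Lemma closed_symmx n : closed (@symmx R n).
Proof.
have -> : @symmx R n = \bigcap_(ij in [set: 'I_n * 'I_n])
    [set M : 'M[R]_n | M ij.2 ij.1 - M ij.1 ij.2 = 0].
  apply/seteqP; split=> [M Ms [i j] _ /=|M Ms]; first by rewrite -{1}Ms mxE subrr.
  by apply/matrixP => i j; rewrite mxE; apply/eqP; rewrite -subr_eq0; exact/eqP/(Ms (i, j)).
apply: closed_bigI => -[i j] _; apply: (@preimage_closed _ _ _ [set 0]); last exact: closed_eq.
by move=> M _; apply: continuousB; exact: coord_continuous.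
Qed.

Lemma closed_superlevel (T : topologicalType) (D : set T) (F : T -> R) c :
  closed D -> {within D, continuous F} -> closed (D `&` [set x | c <= F x]).
Proof.
move=> Dcl /subspace_continuousP Fc x xcl.
have Dx : D x by apply: Dcl; apply: closureS xcl => y [].
split => //=; rewrite leNgt; apply/negP => Fx.
have : \forall y \near within D (nbhs x), F y < c by move: (Fc _ Dx) => /cvgr_lt; apply.
by rewrite near_withinE => /xcl[y [[Dy /= Fy] /(_ Dy)]]; rewrite ltNge Fy.
Qed.

Lemma opnorm_ge0 n (N : 'M[R]_n) : 0 <= opnorm N.
Proof.
rewrite /opnorm; set S := [set _ | _ in _].
have [[[y Sy] ub]|no_sup] := pselect (has_sup S); last by rewrite sup_out.
by apply: le_trans (ub_le_sup ub Sy); case: Sy => x _ <-; exact: sqrtr_ge0.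
Qed.

Lemma unif_elliptic_psd_le n (F : 'M[R]_n -> R) lam Lam M N :
  unif_elliptic F lam Lam -> symmx M -> symmx N -> psd N -> F M <= F (M + N).
Proof.
move=> [lam0 [_ Fell]] Ms Ns Np; have [ge _] := Fell M N Ms Ns Np.
by rewrite -subr_ge0; apply: le_trans ge; rewrite mulr_ge0 ?opnorm_ge0// ltW.
Qed.

Lemma elliptic_separation n (F : 'M[R]_n -> R) lam Lam M0 : (0 < n)%N ->
  unif_elliptic F lam Lam -> {within [set M | symmx M], continuous F} ->
  quasiconcave F -> symmx M0 -> F M0 < 0 ->
  exists A (c : R), [/\ symmx A, psd A, 0 < \tr A,
    forall M, symmx M -> 0 <= F M -> c <= \tr (A *m M) & \tr (A *m M0) < c].
Proof.
move=> n0 Fell Fc Fq M0s FM0; pose K := @symmx R n `&` [set M | 0 <= F M].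
have Kcl : closed K by apply: closed_superlevel; [exact: closed_symmx|exact: Fc].
have Kconv : convex_set K.
  apply/convex_setP => M N t [Ms /= FM] [Ns /= FN] t01; split.
    by rewrite /symmx linearD/= !linearZ/= Ms Ns.
  by apply: le_trans (Fq _ _ _ Ms Ns t01); rewrite le_min FM.
have Kup M N : K M -> symmx N -> psd N -> K (M + N).
  move=> [Ms FM] Ns Np; split; first by rewrite /symmx linearD/= Ms Ns.
  exact: le_trans FM (unif_elliptic_psd_le Fell Ms Ns Np).
have KM0 : ~ K M0 by move=> [_ /=]; rewrite leNgt FM0.
have [A [c [As Ap At Ac AM0]]] := psd_separation n0 Kcl (@subIsetl _ _ _) Kconv Kup M0s KM0.
by exists A, c; split => // M Ms FM; exact: Ac.
Qed.

End Separation.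

(** * Polynomial functions *)

Section InjectiveImpliesSurjective.
Variables (K : fieldType) (V : lmodType K).

Lemma span_lt_dependent (I : finType) (m : I -> V) N (v : 'I_N -> V) :
  (#|I| < N)%N -> (forall k, exists a : I -> K, v k = \sum_i a i *: m i) ->
  exists2 b : 'I_N -> K, exists k, b k != 0 & \sum_k b k *: v k = 0.
Proof.
move=> IN /choice[a vE]; pose A : 'M[K]_(N, #|I|) := \matrix_(k, l) a k (enum_val l).
have : kermx A != 0.
  by rewrite -mxrank_eq0 mxrank_ker subn_eq0 -ltnNge (leq_ltn_trans _ IN)// rank_leq_col.
move=> /rowV0Pn[b /sub_kermxP bA /rV0Pn[k bk]]; exists (b ord0); first by exists k.
under eq_bigr => l _ do rewrite vE scaler_sumr.
rewrite exchange_big big1// => i _ /=.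
under eq_bigr => l _ do rewrite scalerA.
rewrite -scaler_suml [X in X *: _](_ : _ = (b *m A) ord0 (enum_rank i)).
  by rewrite bA mxE scale0r.
by rewrite mxE; apply: eq_bigr => l _; rewrite mxE enum_rankK.
Qed.

Variables (P : V -> Prop) (T : V -> V).
Hypothesis P0 : P 0.
Hypothesis Plin : forall a f g, P f -> P g -> P (a *: f + g).
Hypothesis PT : forall f, P f -> P (T f).
Hypothesis Tlin : forall a f g, P f -> P g -> T (a *: f + g) = a *: T f + T g.
Hypothesis Tinj : forall f, P f -> T f = 0 -> f = 0.

Lemma linear_on0 : T 0 = 0.
Proof. by have := Tlin (-1) P0 P0; rewrite scaler0 addr0 scaleN1r addNr. Qed.

Lemma linear_onZ a f : P f -> P (a *: f) /\ T (a *: f) = a *: T f.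
Proof.
by move=> Pf; rewrite -[a *: f]addr0; split; [exact: Plin|rewrite Tlin// linear_on0 addr0].
Qed.

Lemma linear_on_sum N (a : nat -> K) (f : nat -> V) : (forall k, P (f k)) ->
  P (\sum_(k < N) a k *: f k) /\
  T (\sum_(k < N) a k *: f k) = \sum_(k < N) a k *: T (f k).
Proof.
move=> Pf; elim: N => [|N [IP IT]]; first by rewrite !big_ord0 linear_on0.
by rewrite !big_ord_recr/= addrC; split; [exact: Plin|rewrite Tlin// IT addrC].
Qed.

Lemma iter_relation_surjective N (a : nat -> K) g : P g ->
  (exists2 k, (k < N)%N & a k != 0) -> \sum_(k < N) a k *: iter k T g = 0 ->
  exists2 f, P f & T f = g.
Proof.
move=> Pg; have Piter k : P (iter k T g) by elim: k => //= k; exact: PT.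
elim: N a => [|N IH] a [k kN ak]; first by [].
rewrite big_ord_recl/=; have [Ps Ts] := linear_on_sum N (fun k => a k.+1) Piter.
rewrite -Ts; have [a0|a0] := eqVneq (a 0%N) 0.
  rewrite a0 scale0r add0r => /(Tinj Ps); apply: (IH (fun k => a k.+1)).
  by case: k kN ak => [|k] kN ak; [rewrite a0 eqxx in ak|exists k].
move=> /eqP; rewrite addrC addr_eq0 => /eqP TsE.
have [Pf Tf] := linear_onZ (- (a 0%N)^-1) Ps; eexists; first exact: Pf.
by rewrite Tf TsE scaleNr scalerN opprK scalerA mulVf// scale1r.
Qed.

(* The vectors [g], [T g], [T (T g)], ... are linearly dependent; cancelling [T] until the
   relation has a nonzero constant coefficient exhibits [g] as a value of [T]. *)
Lemma injective_span_surjective (I : finType) (m : I -> V) :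
  (forall f, P f -> exists a : I -> K, f = \sum_i a i *: m i) ->
  forall g, P g -> exists2 f, P f & T f = g.
Proof.
move=> Pspan g Pg.
have Piter k : P (iter k T g) by elim: k => //= k; exact: PT.
have [b [k bk] rel] :=
  span_lt_dependent (ltnSn #|I|) (fun k : 'I_#|I|.+1 => Pspan _ (Piter k)).
apply: (@iter_relation_surjective #|I|.+1 (fun k => b (inord k)) g Pg).
  by exists k => //; rewrite inord_val.
by rewrite -[RHS]rel; apply: eq_bigr => l _; rewrite inord_val.
Qed.

End InjectiveImpliesSurjective.

Lemma poly_near_eq0 (R : realType) (Q : {poly R}) (c : R) : (\forall t \near c, Q.[t] = 0) -> Q = 0.
Proof.
move=> /nbhs_normP[d /= d0 dQ]; apply/eqP; apply: contraT => Q0.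
pose rs := [seq c + d / k.+2%:R | k <- iota 0 (size Q)].
suff : (size rs < size Q)%N by rewrite size_map size_iota ltnn.
apply: max_poly_roots => //.
  apply/allP => _ /mapP[k _ ->]; apply/eqP/dQ.
  rewrite /ball_/= opprD addNKr normrN gtr0_norm ?divr_gt0//.
  by rewrite ltr_pdivrMr// ltr_pMr// ltr1n.
rewrite map_inj_uniq ?iota_uniq// => k l /addrI/(mulfI (lt0r_neq0 d0))/invr_inj/eqP.
by rewrite eqr_nat => /eqP[].
Qed.

Section PolynomialFunctions.
Context {R : realType} {n : nat}.
Implicit Types (f g : 'rV[R]_n -> R) (x y z : 'rV[R]_n) (o : option 'I_n).

Definition affine_coord o : 'rV[R]_n -> R :=
  fun x => if o is Some i then x ord0 i else 1.

(* [polyfun d f]: [f] is a polynomial function of total degree at most [d]. *)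
Fixpoint polyfun d f : Prop :=
  if d is d'.+1 then
    exists2 g : option 'I_n -> 'rV[R]_n -> R,
      forall o, polyfun d' (g o) & f = \sum_o affine_coord o * g o
  else exists c, f = cst c.

Lemma polyfun_lin d (a : R) f g : polyfun d f -> polyfun d g -> polyfun d (a *: f + g).
Proof.
elim: d f g => [|d IH] f g; first by move=> [c ->] [c' ->]; exists (a * c + c').
move=> [f' Pf' ->] [g' Pg' ->]; exists (fun o => a *: f' o + g' o).
  by move=> o; exact: (IH _ _ (Pf' o) (Pg' o)).
rewrite scaler_sumr -big_split; apply: eq_bigr => o _; apply/funext => x.
rewrite -[LHS]/(a * (affine_coord o x * f' o x) + affine_coord o x * g' o x).
by rewrite -[RHS]/(affine_coord o x * (a * f' o x + g' o x)); ring.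
Qed.

Lemma polyfun_cst d c : polyfun d (cst c).
Proof.
elim: d c => [|d IH] c; first by exists c.
exists (fun o => cst (if o is None then c else 0)); first by move=> o; exact: IH.
apply/funext => x.
rewrite fct_sumE (bigD1 None)//= big1 => [|[i|]//]; rewrite !fctE ?mulr0//.
by rewrite mul1r addr0.
Qed.

Lemma polyfunZ d (a : R) f : polyfun d f -> polyfun d (a *: f).
Proof. by rewrite -[a *: f]addr0 => Pf; apply: polyfun_lin => //; exact: polyfun_cst. Qed.

Lemma polyfunD d f g : polyfun d f -> polyfun d g -> polyfun d (f + g).
Proof. by rewrite -[f in f + _]scale1r; exact: polyfun_lin. Qed.

Lemma polyfun_sum d (I : Type) (r : seq I) (f : I -> 'rV[R]_n -> R) :
  (forall i, polyfun d (f i)) -> polyfun d (\sum_(i <- r) f i).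
Proof.
move=> Pf; elim/big_rec: _ => [|i g _]; first exact: polyfun_cst.
exact: polyfunD.
Qed.

Lemma polyfun_coordM d o f : polyfun d f -> polyfun d.+1 (affine_coord o * f).
Proof.
move=> Pf; exists (fun o' => if o' == o then f else cst 0).
  by move=> o'; case: eqP => _ //; exact: polyfun_cst.
by rewrite (bigD1 o)//= eqxx big1 => [|o' /negbTE ->]; [exact/esym/addr0|exact: mulr0].
Qed.

Lemma polyfunS d f : polyfun d f -> polyfun d.+1 f.
Proof. by rewrite -[X in _ -> polyfun _ X]mul1r; exact: (@polyfun_coordM d None). Qed.

Lemma continuous_affine_coord o : continuous (affine_coord o).
Proof. by case: o => [i|]; [exact: coord_continuous|exact: cst_continuous]. Qed.

Lemma polyfun_continuous d f : polyfun d f -> continuous f.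
Proof.
elim: d f => [|d IH] f; first by move=> [c ->]; exact: cst_continuous.
move=> [g Pg ->] x; apply: continuous_at_sum => o.
by apply: continuousM; [exact: continuous_affine_coord|exact: (IH _ (Pg o))].
Qed.

Lemma is_derive_coord x (i j : 'I_n) :
  is_derive x (evec R j) (fun y : 'rV[R]_n => y ord0 i) (i == j)%:R.
Proof.
pose coord (y : 'rV[R]_n) := y ord0 i.
have quotient_cvg : (h^-1 *: ((coord \o shift x) (h *: evec R j) - coord x) @[h --> 0^']) -->
    ((i == j)%:R : R).
  apply: cvg_near_cst; near=> h.
  rewrite /coord/= !mxE addrK eqxx/= eq_sym -[_ *: _]/(_ * _) mulrA mulVf ?mul1r//.
  by near: h; exact: nbhs_dnbhs_neq.
by split; [apply/cvg_ex; eexists; exact: quotient_cvg|exact: cvg_lim quotient_cvg].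
Unshelve. all: end_near. Qed.

Lemma is_derive_affine_coord x o (j : 'I_n) :
  is_derive x (evec R j) (affine_coord o) (o == Some j)%:R.
Proof. by case: o => [i|]; [exact: is_derive_coord|exact: is_derive_cst]. Qed.

Lemma is_derive_sum_coordM (g : option 'I_n -> 'rV[R]_n -> R) x i :
  (forall o, derivable (g o) x (evec R i)) ->
  is_derive x (evec R i) (\sum_o affine_coord o * g o)
    (\sum_o affine_coord o x * partial i (g o) x + g (Some i) x).
Proof.
move=> gd; have -> : \sum_o affine_coord o x * partial i (g o) x + g (Some i) x =
    \sum_o (affine_coord o x *: partial i (g o) x + g o x *: (o == Some i)%:R).
  rewrite big_split/=; congr (_ + _); rewrite (bigD1 (Some i))//= eqxx big1 => [|o /negbTE ->].
    by rewrite addr0 [RHS]mulr1.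
  exact: mulr0.
apply: is_derive_big_sum => o; apply: is_deriveM; first exact: is_derive_affine_coord.
exact: derivableP.
Qed.

Lemma polyfun_derivable d f x i : polyfun d f -> derivable f x (evec R i).
Proof.
elim: d f => [|d IH] f; first by move=> [c ->]; exact: derivable_cst.
move=> [g Pg ->]; have [] := @is_derive_sum_coordM g x i => // o.
exact: (IH _ (Pg o)).
Qed.

Lemma partial_sum_coordM (g : option 'I_n -> 'rV[R]_n -> R) i :
  (forall o x, derivable (g o) x (evec R i)) ->
  partial i (\sum_o affine_coord o * g o) =
    \sum_o affine_coord o * partial i (g o) + g (Some i).
Proof.
move=> gd; apply/funext => x; rewrite addrfctE [in RHS]fct_sumE.
by have [_ partialE] := is_derive_sum_coordM (gd^~ x); exact: partialE.
Qed.

Lemma polyfun_partial d f i : polyfun d.+1 f -> polyfun d (partial i f).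
Proof.
elim: d f => [|d IH] f [g Pg ->].
  rewrite partial_sum_coordM => [|o x]; last exact: (@polyfun_derivable 0 _ _ _ (Pg o)).
  rewrite big1 ?add0r// => o _; have [c ->] := Pg o.
  by apply/funext => x; rewrite mulrfctE [partial _ _ x]derive_cst mulr0.
rewrite partial_sum_coordM => [|o x]; last exact: (@polyfun_derivable d.+1 _ _ _ (Pg o)).
apply: polyfunD; last exact: Pg.
by apply: polyfun_sum => o; apply: polyfun_coordM; exact: (IH _ (Pg o)).
Qed.

Lemma polyfun_C2_at d f x : polyfun d f -> C2_at f x.
Proof.
move=> /polyfunS/polyfunS Pf; split; first exact: polyfun_continuous Pf _.
move=> i; have Pfi := polyfun_partial i Pf; split; first exact: polyfun_derivable Pf.
split; first exact: polyfun_continuous Pfi _.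
move=> j; split; first exact: polyfun_derivable Pfi.
exact: polyfun_continuous (polyfun_partial j Pfi) _.
Qed.

Lemma polyfun_span d : exists (I : finType) (m : I -> 'rV[R]_n -> R),
  forall f, polyfun d f -> exists a : I -> R, f = \sum_k a k *: m k.
Proof.
elim: d => [|d [I [m IH]]].
  exists unit, (fun=> cst 1) => f [c ->]; exists (fun=> c).
  by rewrite (bigD1 tt)//= big1 ?addr0 => [|[]//]; apply/funext => x; exact/esym/mulr1.
exists (option 'I_n * I)%type, (fun ok => affine_coord ok.1 * m ok.2).
move=> f [g Pg ->]; have [a gE] := choice (fun o => IH _ (Pg o)).
exists (fun ok => a ok.1 ok.2).
rewrite -(pair_bigA _ (fun o k => a o k *: (affine_coord o * m k)))/=.
apply: eq_bigr => o _; rewrite gE mulr_sumr; apply: eq_bigr => k _.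
by apply/funext => x; exact: mulrCA.
Qed.

Lemma polyfun_line d f x y : polyfun d f ->
  exists Q : {poly R}, forall t, f (x + t *: y) = Q.[t].
Proof.
elim: d f => [|d IH] f; first by move=> [c ->]; exists c%:P => t; rewrite hornerC.
move=> [g Pg ->]; have [Q QE] := choice (fun o => IH _ (Pg o)).
exists (\sum_o (if o is Some i then (x ord0 i)%:P + y ord0 i *: 'X else 1) * Q o) => t.
rewrite fct_sumE horner_sum; apply: eq_bigr => o _; rewrite mulrfctE hornerM QE.
by case: o => [i|]; rewrite /affine_coord !hornerE// !mxE [t * _]mulrC.
Qed.

Lemma polyfun_near_eq0 d f z : polyfun d f -> (\forall x \near z, f x = 0) -> f = cst 0.
Proof.
move=> Pf f0; apply/funext => x; have [Q QE] := polyfun_line z (x - z) Pf.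
have Q0 : Q = 0.
  by apply: (@poly_near_eq0 _ Q 0); apply: filterS (near_line (x - z) f0) => t; rewrite QE.
by have := QE 1; rewrite Q0 horner0 scale1r addrC subrK.
Qed.

Lemma sqdistM_coord z f (X := fun i : 'I_n => affine_coord (Some i)) :
  sqdist z * f =
    \sum_i (X i * (X i * f) + ((- 2 * z ord0 i) *: (X i * f) + z ord0 i ^+ 2 *: f)).
Proof.
apply/funext => x; rewrite fct_sumE mulrfctE mulr_suml; apply: eq_bigr => i _.
rewrite !mxE -[RHS]/(x ord0 i * (x ord0 i * f x) +
  (- 2 * z ord0 i * (x ord0 i * f x) + z ord0 i ^+ 2 * f x)).
by ring.
Qed.

Lemma polyfun_sqdistM d f z : polyfun d f -> polyfun d.+2 (sqdist z * f).
Proof.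
move=> Pf; rewrite sqdistM_coord; apply: polyfun_sum => i.
have Pxf := polyfun_coordM (Some i) Pf; apply: polyfunD; first exact: polyfun_coordM.
by apply: polyfun_lin; [exact: polyfunS|apply/polyfunZ; do 2 apply: polyfunS].
Qed.

Lemma polyfun_sqdist z : polyfun 2 (sqdist z).
Proof. by rewrite -[sqdist z]mulr1; apply: polyfun_sqdistM; exact: polyfun_cst. Qed.

End PolynomialFunctions.

Section SecondOrderCalculus.
Context {R : realType} {n : nat}.
Implicit Types (f g : 'rV[R]_n -> R) (x y z : 'rV[R]_n) (Omega : set 'rV[R]_n) (a : R).

Lemma C2_on_near Omega f x : open Omega -> C2_on Omega f -> Omega x ->
  \forall y \near x, C2_at f y.
Proof.
move=> Oo f2 Ox; have Onear : \forall y \near x, Omega y by exact: open_nbhs_nbhs.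
by apply: filterS Onear => y /f2.
Qed.

Lemma is_derive_partial_lin a f g i x : derivable f x (evec R i) -> derivable g x (evec R i) ->
  is_derive x (evec R i) (a *: f + g) (a * partial i f x + partial i g x).
Proof. by move=> fd gd; apply: is_deriveD; [apply: is_deriveZ|]; exact: derivableP. Qed.

Section Linearity.
Variables (a : R) (f g : 'rV[R]_n -> R) (x : 'rV[R]_n).
Hypotheses (f2 : \forall y \near x, C2_at f y) (g2 : \forall y \near x, C2_at g y).

Lemma near_partial_lin i :
  \forall y \near x, partial i (a *: f + g) y = (a *: partial i f + partial i g) y.
Proof.
apply: filterS2 f2 g2 => y fy gy.
by have [_ partialE] := @is_derive_partial_lin a _ _ i _ (C2_at_derivable fy) (C2_at_derivable gy);
  exact: partialE.
Qed.

Lemma is_derive_partial2_lin i j : is_derive x (evec R j) (partial i (a *: f + g))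
  (a * partial j (partial i f) x + partial j (partial i g) x).
Proof.
apply: (@near_eq_is_derive _ _ _ (a *: partial i f + partial i g)).
  by apply: filterS (near_partial_lin i) => y ->.
by apply: is_derive_partial_lin; apply: C2_at_derivable_partial;
  [exact: nbhs_singleton f2|exact: nbhs_singleton g2].
Qed.

Lemma partial2_lin i j : partial j (partial i (a *: f + g)) x =
  a * partial j (partial i f) x + partial j (partial i g) x.
Proof. by have [_ partialE] := is_derive_partial2_lin i j; exact: partialE. Qed.

Lemma hessian_lin : hessian (a *: f + g) x = a *: hessian f x + hessian g x.
Proof.
have hessianE h i j : hessian h x i j = partial j (partial i h) x by rewrite mxE.
have linE (M N : 'M[R]_n) i j : (a *: M + N) i j = a * M i j + N i j by rewrite !mxE.
apply/matrixP => i j; rewrite linE; apply: etrans (hessianE _ i j) (etrans (partial2_lin i j) _).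
exact/esym/(congr2 (fun s t => a * s + t) (hessianE f i j) (hessianE g i j)).
Qed.

End Linearity.

Lemma C2_at_lin a f g x : (\forall y \near x, C2_at f y) -> (\forall y \near x, C2_at g y) ->
  C2_at (a *: f + g) x.
Proof.
move=> f2 g2; have [f2x g2x] := (nbhs_singleton f2, nbhs_singleton g2).
have clin (h k : 'rV[R]_n -> R) : {for x, continuous h} -> {for x, continuous k} ->
    {for x, continuous (a *: h + k)}.
  by move=> hc kc; apply: continuousD => //; exact: continuousZl_tmp.
split; first by apply: clin; exact: C2_at_continuous.
move=> i; split.
  by have [] := @is_derive_partial_lin a _ _ i _ (C2_at_derivable f2x) (C2_at_derivable g2x).
split.
  apply: (@near_eq_continuous_at _ _ (a *: partial i f + partial i g)).
    by apply: filterS (near_partial_lin a f2 g2 i) => y ->.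
  by apply: clin; exact: C2_at_continuous_partial.
move=> j; split; first by have [] := is_derive_partial2_lin a f2 g2 i j.
apply: (@near_eq_continuous_at _ _ (a *: partial j (partial i f) + partial j (partial i g))).
  apply: filterS2 (near_join f2) (near_join g2) => y fy gy.
  exact: esym (partial2_lin a fy gy i j).
by apply: clin; exact: C2_at_continuous_partial2.
Qed.

Lemma C2_on_lin Omega a f g : open Omega -> C2_on Omega f -> C2_on Omega g ->
  C2_on Omega (a *: f + g).
Proof. by move=> Oo f2 g2 x Ox; exact: C2_at_lin (C2_on_near Oo f2 Ox) (C2_on_near Oo g2 Ox). Qed.

Lemma polyfun_C2_on d f Omega : polyfun d f -> C2_on Omega f.
Proof. by move=> Pf x _; exact: polyfun_C2_at Pf. Qed.

Lemma polyfun_near_C2_at d f x : polyfun d f -> \forall y \near x, C2_at f y.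
Proof. by move=> Pf; apply: (@nearW _ (nbhs x)) => y; exact: polyfun_C2_at Pf. Qed.

Lemma C2_onZ Omega a f : open Omega -> C2_on Omega f -> C2_on Omega (a *: f).
Proof.
move=> Oo f2; rewrite -[a *: f]addr0; exact: C2_on_lin Oo f2 (polyfun_C2_on (polyfun_cst 0 0)).
Qed.

Lemma C2_onD Omega f g : open Omega -> C2_on Omega f -> C2_on Omega g -> C2_on Omega (f + g).
Proof. by move=> Oo f2; rewrite -[f]scale1r; exact: C2_on_lin. Qed.

Lemma C2_onB Omega f g : open Omega -> C2_on Omega f -> C2_on Omega g -> C2_on Omega (f - g).
Proof. by move=> Oo f2 g2; rewrite addrC -scaleN1r; exact: C2_on_lin. Qed.

Lemma partial_sqdist z i : partial i (sqdist z) =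
  2 *: affine_coord (Some i) + cst (- (2 * z ord0 i)).
Proof.
apply/funext => x.
have -> : sqdist z = \sum_j (affine_coord (Some j) - cst (z ord0 j)) ^+ 2.
  by apply/funext => y; rewrite fct_sumE; apply: eq_bigr => j _; rewrite !mxE.
have [_ partialE] : is_derive x (evec R i)
    (\sum_j (affine_coord (Some j) - cst (z ord0 j)) ^+ 2)
    (\sum_j (2 * (x ord0 j - z ord0 j) * ((j == i)%:R - 0))).
  apply: is_derive_big_sum => j; have coordD := is_derive_coord x j i.
  by apply: is_derive_eq; rewrite -[_ *: _]/(_ * _) expr1 mulr_natl.
rewrite [LHS]partialE (bigD1 i)//= eqxx big1 => [|j /negbTE ->].
  by rewrite addr0 subr0 mulr1 mulrBr.
by rewrite subrr mulr0.
Qed.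

Lemma hessian_sqdist z x : hessian (sqdist z) x = 2%:M.
Proof.
apply/matrixP => i j; rewrite !mxE partial_sqdist.
have [_ partialE] : is_derive x (evec R j)
    (2 *: affine_coord (Some i) + cst (- (2 * z ord0 i))) (2 *: (i == j)%:R + 0).
  by have coordD := is_derive_coord x i j; apply: is_deriveD.
by rewrite [LHS]partialE addr0 -[LHS]/(2 * (i == j)%:R) mulr_natr.
Qed.

End SecondOrderCalculus.

(** * Maximum principle and polynomial Dirichlet problem *)

Lemma cball_max_principle (R : realType) n (f : 'rV[R]_n -> R) z (c m : R) :
  (forall x, cball z c x -> {for x, continuous f}) ->
  (forall p, sqdist z p < c -> (\forall y \near p, f y <= f p) -> f p <= m) ->
  (forall x, sqdist z x = c -> f x <= m) ->
  forall x, cball z c x -> f x <= m.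
Proof.
move=> fc interior sphere x xB.
have cB : {within cball z c, continuous f}.
  by apply: continuous_in_subspaceT => y /set_mem/fc.
have [p /set_mem pB pmax] :=
  compact_EVT_max (ex_intro _ x xB) (@compact_cball R n z c) cB.
apply: (@le_trans _ _ (f p)); first exact/pmax/mem_set.
have [pc|pc] := eqVneq (sqdist z p) c; first exact: sphere.
have pc' : sqdist z p < c by rewrite lt_neqAle pc.
apply: interior => //; apply: filterS (near_sqdist_lt pc') => y /ltW yB.
exact/pmax/mem_set.
Qed.

Section TraceHessian.
Context {R : realType} {n : nat}.
Variable A : 'M[R]_n.
Implicit Types (f g p q : 'rV[R]_n -> R) (x y z : 'rV[R]_n) (Omega : set 'rV[R]_n).

Definition tr_hessian f x : R := \tr (A *m hessian f x).

Lemma tr_hessian_lin (a : R) f g x :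
  (\forall y \near x, C2_at f y) -> (\forall y \near x, C2_at g y) ->
  tr_hessian (a *: f + g) x = a * tr_hessian f x + tr_hessian g x.
Proof.
move=> f2 g2; rewrite /tr_hessian (hessian_lin a f2 g2).
by rewrite mulmxDr mxtraceD -scalemxAr mxtraceZ.
Qed.

Lemma tr_hessianZ a f x : (\forall y \near x, C2_at f y) ->
  tr_hessian (a *: f) x = a * tr_hessian f x.
Proof.
have c2 : \forall y \near x, C2_at (0 : 'rV[R]_n -> R) y.
  exact: polyfun_near_C2_at (polyfun_cst 0 0).
move=> f2; have := tr_hessian_lin (-1) c2 c2; rewrite scaler0 addr0 mulN1r addNr => tr0.
by have := tr_hessian_lin a f2 c2; rewrite [a *: f + 0]addr0 tr0 [_ + 0]addr0.
Qed.

Lemma tr_hessianD f g x : (\forall y \near x, C2_at f y) -> (\forall y \near x, C2_at g y) ->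
  tr_hessian (f + g) x = tr_hessian f x + tr_hessian g x.
Proof. by move=> f2 g2; rewrite -[f in LHS]scale1r tr_hessian_lin// mul1r. Qed.

Lemma tr_hessianB f g x : (\forall y \near x, C2_at f y) -> (\forall y \near x, C2_at g y) ->
  tr_hessian (f - g) x = tr_hessian f x - tr_hessian g x.
Proof. by move=> f2 g2; rewrite addrC -scaleN1r tr_hessian_lin// mulN1r addrC. Qed.

Lemma tr_hessianE f :
  tr_hessian f = \sum_i \sum_k A i k *: partial i (partial k f).
Proof.
apply/funext => x; rewrite fct_sumE; apply: eq_bigr => i _; rewrite mxE fct_sumE.
by apply: eq_bigr => k _; rewrite mxE.
Qed.

Lemma tr_hessian_continuous f x : C2_at f x -> {for x, continuous (tr_hessian f)}.
Proof.
move=> f2; rewrite tr_hessianE; do 2 (apply: continuous_at_sum => ?).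
by apply: continuousZl_tmp; exact: C2_at_continuous_partial2.
Qed.

Lemma polyfun_tr_hessian d f : polyfun d.+2 f -> polyfun d (tr_hessian f).
Proof.
move=> Pf; rewrite tr_hessianE; do 2 (apply: polyfun_sum => ?).
by apply: polyfunZ; do 2 apply: polyfun_partial.
Qed.

Lemma tr_hessian_sqdist z x : tr_hessian (sqdist z) x = 2 * \tr A.
Proof. by rewrite /tr_hessian hessian_sqdist mul_mx_scalar mxtraceZ. Qed.

Hypotheses (As : symmx A) (Ap : psd A) (At : 0 < \tr A).

Lemma tr_hessian_local_max f x : (\forall y \near x, C2_at f y) ->
  (\forall y \near x, f y <= f x) -> tr_hessian f x <= 0.
Proof.
move=> f2 fmax; apply: trace_mul_psd_nsd_le0 => // a.
exact: second_derivative_test f2 fmax.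
Qed.

Lemma tr_hessian_max_principle Omega f z (c m : R) : 0 < c ->
  open Omega -> C2_on Omega f -> cball z c `<=` Omega ->
  (forall x, sqdist z x < c -> 0 <= tr_hessian f x) ->
  (forall x, sqdist z x = c -> f x <= m) ->
  forall x, cball z c x -> f x <= m.
Proof.
move=> c0 Oo f2 BO Lf fm x xB; apply/ler_addgt0Pr => e e0.
have ec : 0 < e / c by rewrite divr_gt0.
have s2 : C2_on Omega (sqdist z) := polyfun_C2_on (polyfun_sqdist z).
pose h : 'rV[R]_n -> R := (e / c) *: sqdist z + f.
have hE y : h y = e / c * sqdist z y + f y by [].
have h2 : C2_on Omega h by exact: C2_on_lin.
suff : h x <= m + e.
  by apply: le_trans; rewrite hE lerDr mulr_ge0 ?sqdist_ge0// ltW.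
apply: (cball_max_principle _ _ _ xB) => [y /BO/h2[]//|p pc pmax|y yc]; last first.
  by rewrite hE yc divfK ?gt_eqF// addrC lerD2r fm.
have Op : Omega p by apply: BO; exact: ltW.
have := tr_hessian_local_max (C2_on_near Oo h2 Op) pmax.
rewrite (tr_hessian_lin _ (C2_on_near Oo s2 Op) (C2_on_near Oo f2 Op)) tr_hessian_sqdist.
rewrite leNgt ltr_wpDr ?Lf//.
by rewrite mulr_gt0// mulr_gt0.
Qed.

Lemma tr_hessian_eq0_unique Omega q z (c : R) : 0 < c ->
  open Omega -> C2_on Omega q -> cball z c `<=` Omega ->
  (forall x, sqdist z x < c -> tr_hessian q x = 0) ->
  (forall x, sqdist z x = c -> q x = 0) ->
  forall x, cball z c x -> q x = 0.
Proof.
move=> c0 Oo q2 BO Lq q0.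
have q_le0 p : C2_on Omega p -> (forall x, sqdist z x < c -> tr_hessian p x = 0) ->
    (forall x, sqdist z x = c -> p x = 0) -> forall x, cball z c x -> p x <= 0.
  move=> p2 Lp p0; apply: (tr_hessian_max_principle c0 Oo p2 BO) => x xc.
    by rewrite Lp.
  by rewrite p0.
move=> x xB; apply/le_anti/andP; split; first exact: q_le0.
rewrite -oppr_le0 -[- q x]/((- q) x) -scaleN1r.
apply: q_le0 xB => [|y yc|y yc]; first exact: C2_onZ.
  have Oy : Omega y by apply: BO; exact: ltW.
  by rewrite (tr_hessianZ _ (C2_on_near Oo q2 Oy)) Lq// mulr0.
by rewrite scaleN1r opprfctE q0// oppr0.
Qed.

End TraceHessian.

Section PolynomialDirichlet.
Context {R : realType} {n : nat}.
Variables (A : 'M[R]_n) (z : 'rV[R]_n) (c : R).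
Hypotheses (As : symmx A) (Ap : psd A) (At : 0 < \tr A) (c0 : 0 < c).
Implicit Types (f g p q : 'rV[R]_n -> R) (x : 'rV[R]_n).

Definition ball_mul p : 'rV[R]_n -> R := c *: p - sqdist z * p.

Lemma ball_mulE p x : ball_mul p x = (c - sqdist z x) * p x.
Proof. by rewrite [LHS]/(c * p x - sqdist z x * p x) mulrBl. Qed.

Lemma ball_mul_lin (a : R) p q : ball_mul (a *: p + q) = a *: ball_mul p + ball_mul q.
Proof.
apply/funext => x; rewrite ball_mulE.
rewrite -[RHS]/(a * ball_mul p x + ball_mul q x) !ball_mulE.
by rewrite -[(a *: p + q) x]/(a * p x + q x); ring.
Qed.

Lemma polyfun_ball_mul d p : polyfun d p -> polyfun d.+2 (ball_mul p).
Proof.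
move=> Pp; rewrite /ball_mul addrC -scaleN1r; apply: polyfun_lin.
  exact: polyfun_sqdistM.
by do 2 apply: polyfunS; exact: polyfunZ.
Qed.

Definition dirichlet_op p := tr_hessian A (ball_mul p).

Lemma dirichlet_op_eq0 d p : polyfun d p -> dirichlet_op p = 0 -> p = 0.
Proof.
move=> Pp Tp; apply: (polyfun_near_eq0 Pp (z := z)).
have zc : sqdist z z < c by rewrite sqdistxx.
apply: filterS (near_sqdist_lt zc) => x xc.
have : ball_mul p x = 0.
  apply: (tr_hessian_eq0_unique As Ap At c0 openT (polyfun_C2_on (polyfun_ball_mul Pp)))
    (ltW xc) => [//|y _|y yc]; first by rewrite -/(dirichlet_op p) Tp.
  by rewrite ball_mulE yc subrr mul0r.
by move/eqP; rewrite ball_mulE mulf_eq0 subr_eq0 gt_eqF//= => /eqP.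
Qed.

Lemma dirichlet_op_surjective d q : polyfun d q -> exists2 p, polyfun d p & dirichlet_op p = q.
Proof.
have [I [m span]] := @polyfun_span R n d; move: q.
apply: (@injective_span_surjective R _ (polyfun d) dirichlet_op _ _ _ _ _ I m span).
- exact: polyfun_cst.
- exact: polyfun_lin.
- by move=> p Pp; apply: polyfun_tr_hessian; exact: polyfun_ball_mul.
- move=> a p1 p2 Pp1 Pp2; apply/funext => x; rewrite /dirichlet_op ball_mul_lin.
  by apply: (@tr_hessian_lin R n A a); [exact: polyfun_near_C2_at _ (polyfun_ball_mul Pp1)
    |exact: polyfun_near_C2_at _ (polyfun_ball_mul Pp2)].
- exact: dirichlet_op_eq0.
Qed.

(* The solution is sought in the form [g + (c - |x - z|^2) p], with [p] of degree at most [d]. *)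
Lemma polyfun_dirichlet d g k : polyfun d g ->
  exists h, [/\ polyfun d.+2 h, forall x, tr_hessian A h x = k &
    forall x, sqdist z x = c -> h x = g x].
Proof.
move=> Pg; have Pg2 := polyfunS (polyfunS Pg).
have [p Pp TpE] : exists2 p, polyfun d p & dirichlet_op p = (-1) *: tr_hessian A g + cst k.
  apply: dirichlet_op_surjective; apply: polyfun_lin; last exact: polyfun_cst.
  exact: polyfun_tr_hessian.
have Pq := polyfun_ball_mul Pp.
exists (ball_mul p + g); split; first exact: polyfunD.
- move=> x; rewrite (tr_hessianD _ (polyfun_near_C2_at _ Pq) (polyfun_near_C2_at _ Pg2)).
  have -> : tr_hessian A (ball_mul p) x = - tr_hessian A g x + k.
    by rewrite -[LHS]/(dirichlet_op p x) TpE -[LHS]/(-1 * tr_hessian A g x + k) mulN1r.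
  by rewrite addrAC addNr add0r.
- by move=> x xc; rewrite addrfctE ball_mulE xc subrr mul0r add0r.
Qed.

End PolynomialDirichlet.

(** * Polynomial approximation *)

Section RandomWalk.
Context {R : realType} {n : nat} {I : finType}.
Variables (wt : I -> 'rV[R]_n -> R) (step : I -> 'rV[R]_n) (h : R).
Implicit Types (f g : 'rV[R]_n -> R) (s x t : 'rV[R]_n).

(* Expectation of [f] after [k] steps of length [h] from [s], the step [o] being taken with
   probability [wt o x]: a Bernstein polynomial in [x] when the weights are affine. *)
Fixpoint walk k f s x : R :=
  if k is k'.+1 then \sum_o wt o x * walk k' f (s + h *: step o) x else f s.

Lemma polyfun_walk k f s :
  (forall o d g, polyfun d g -> polyfun d.+1 (wt o * g)) -> polyfun k (walk k f s).
Proof.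
move=> wtP; elim: k s => [|k IH] s; first by exists (f s).
have -> : walk k.+1 f s = \sum_o wt o * walk k f (s + h *: step o).
  by apply/funext => x; rewrite fct_sumE.
by apply: polyfun_sum => o; exact: wtP.
Qed.

Lemma walk_lin k (a : R) f g s x :
  walk k (a *: f + g) s x = a * walk k f s x + walk k g s x.
Proof.
elim: k s => //= k IH s; rewrite mulr_sumr -big_split/=; apply: eq_bigr => o _.
by rewrite IH; ring.
Qed.

Lemma walk_cst k (a : R) s x : \sum_o wt o x = 1 -> walk k (cst a) s x = a.
Proof.
move=> wt1; elim: k s => //= k IH s; under eq_bigr => o _ do rewrite IH.
by rewrite -mulr_suml wt1 mul1r.
Qed.

Lemma ler_walk k f g s x : (forall o, 0 <= wt o x) -> (forall y, f y <= g y) ->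
  walk k f s x <= walk k g s x.
Proof.
move=> wt0 fg; elim: k s => //= k IH s; apply: ler_sum => o _.
exact: ler_wpM2l.
Qed.

Lemma ler_norm_walk k f s x : (forall o, 0 <= wt o x) ->
  `|walk k f s x| <= walk k (fun y => `|f y|) s x.
Proof.
move=> wt0; elim: k s => //= k IH s; apply: le_trans (ler_norm_sum _ _ _) _.
by apply: ler_sum => o _; rewrite normrM ger0_norm// ler_wpM2l.
Qed.

Lemma dotrv_expectation t x w : \sum_o wt o x *: step o = w ->
  \sum_o wt o x * dotrv t (step o) = dotrv t w.
Proof.
move=> <-; rewrite /dotrv; under eq_bigr => o _ do rewrite mulr_sumr.
rewrite exchange_big; apply: eq_bigr => i _; rewrite summxE mulr_sumr.
by apply: eq_bigr => o _; rewrite mxE; ring.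
Qed.

Lemma walk_sqdist k s x w (V : R) : \sum_o wt o x = 1 -> \sum_o wt o x *: step o = w ->
  \sum_o wt o x * sqnorm (step o) = V ->
  walk k (sqdist x) s x = sqnorm (s - x + (k%:R * h) *: w) + k%:R * h ^+ 2 * (V - sqnorm w).
Proof.
move=> wt1 mean var; elim: k s => [|k IH] s; first by rewrite !mul0r scale0r !addr0.
rewrite /=; pose t := s - x + (k%:R * h) *: w.
have -> : s - x + (k.+1%:R * h) *: w = t + h *: w.
  by rewrite /t -[RHS]addrA -scalerDl -[k.+1]addn1 natrD mulrDl mul1r.
have stepE o : walk k (sqdist x) (s + h *: step o) x =
    sqnorm t + k%:R * h ^+ 2 * (V - sqnorm w) +
    (2 * h * dotrv t (step o) + h ^+ 2 * sqnorm (step o)).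
  rewrite IH [s + _ - x]addrAC [s - x + _ + _]addrAC -/t sqnormD.
  by ring.
under eq_bigr => o _.
  rewrite stepE mulrDr [X in _ + X](_ : _ = 2 * h * (wt o x * dotrv t (step o)) +
    h ^+ 2 * (wt o x * sqnorm (step o))); last by ring.
  over.
rewrite big_split/= -mulr_suml wt1 mul1r big_split/= -!mulr_sumr.
rewrite (dotrv_expectation t mean) var sqnormD -[k.+1]addn1 natrD.
by ring.
Qed.

(* At the end of the walk, the mean is [x] and the variance is at most [V / k]. *)
Lemma walk_approx k f x (e C V : R) : k%:R * h = 1 -> 0 <= C ->
  (forall o, 0 <= wt o x) -> \sum_o wt o x = 1 -> \sum_o wt o x *: step o = x ->
  \sum_o wt o x * sqnorm (step o) = V ->
  (forall y, `|f y - f x| <= e + C * sqdist x y) ->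
  `|walk k f 0 x - f x| <= e + C * (h * V).
Proof.
move=> kh C0 wt0 wt1 mean var fle.
have -> : walk k f 0 x - f x = walk k (-1 *: cst (f x) + f) 0 x.
  by rewrite walk_lin walk_cst// mulN1r addrC.
apply: le_trans (ler_norm_walk _ _ _ wt0) _.
apply: (@le_trans _ _ (walk k (C *: sqdist x + cst e) 0 x)).
  apply: ler_walk => // y; rewrite -[leLHS]/(`|-1 * f x + f y|) -[leRHS]/(C * sqdist x y + e).
  by rewrite mulN1r [- f x + _]addrC [_ + e]addrC; exact: fle.
rewrite walk_lin walk_cst// (walk_sqdist _ _ wt1 mean var) kh scale1r sub0r addNr sqnorm0 add0r.
have -> : k%:R * h ^+ 2 = h by rewrite expr2 mulrA kh mul1r.
have h0 : 0 <= h by have := ler0n R k; nra.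
by rewrite addrC lerD2l ler_wpM2l// ler_wpM2l// gerBl sqnorm_ge0.
Qed.

End RandomWalk.

Lemma sum_pair_bool (V : nmodType) (I : finType) (F : I * bool -> V) :
  \sum_o F o = \sum_i (F (i, true) + F (i, false)).
Proof.
rewrite (eq_bigr (fun o => F (o.1, o.2))) => [|[]//].
rewrite -(pair_bigA _ (fun i b => F (i, b)))/=.
by apply: eq_bigr => i _; rewrite big_bool.
Qed.

Section CrossPolytopeWalk.
Context {R : realType} {n : nat}.
Variable r : R.
Hypotheses (n0 : (0 < n)%N) (r0 : 0 < r).
Implicit Types (x : 'rV[R]_n) (o : 'I_n * bool).

Definition cross_weight o x : R := (1 + (-1) ^+ o.2 * (x ord0 o.1 / r)) / (2 * n%:R).

Definition cross_step o : 'rV[R]_n := ((-1) ^+ o.2 * n%:R * r) *: evec R o.1.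

Let nR0 : n%:R != 0 :> R.
Proof. by rewrite pnatr_eq0 -lt0n. Qed.

Lemma cross_weight_ge0 o x : `|x| <= r -> 0 <= cross_weight o x.
Proof.
move=> xr; rewrite divr_ge0 ?mulr_ge0 ?ler0n//.
have : `|x ord0 o.1 / r| <= 1.
  by rewrite normrM normfV (gtr0_norm r0) ler_pdivrMr// mul1r (le_trans (ler_norm_coord _ _)).
by rewrite ler_norml; case: o.2 => /andP[? ?]; rewrite ?expr1 ?expr0; lra.
Qed.

Lemma sum_cross_weight x : \sum_o cross_weight o x = 1.
Proof.
rewrite sum_pair_bool; have pairE (i : 'I_n) :
    cross_weight (i, true) x + cross_weight (i, false) x = n%:R^-1.
  by rewrite /cross_weight/= expr1 expr0; field; rewrite nR0 gt_eqF.
under eq_bigr => i _ do rewrite pairE.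
by rewrite sumr_const card_ord -[LHS]mulr_natr mulVf.
Qed.

Lemma mean_cross_step x : \sum_o cross_weight o x *: cross_step o = x.
Proof.
rewrite sum_pair_bool; apply/rowP => i; rewrite summxE (bigD1 i)//= big1 => [|j /negbTE ji].
  by rewrite !mxE !eqxx /cross_weight/= expr1 expr0; field; rewrite nR0 gt_eqF.
by rewrite !mxE [i == j]eq_sym ji/= !mulr0 addr0.
Qed.

Lemma sqnorm_cross_step o : sqnorm (cross_step o) = (n%:R * r) ^+ 2.
Proof.
rewrite /sqnorm (bigD1 o.1)//= big1 => [|j /negbTE ji]; rewrite !mxE ?eqxx ?ji/=.
  by rewrite mulr1 addr0 -mulrA exprMn sqrr_sign mul1r.
by rewrite mulr0 expr0n.
Qed.

Lemma var_cross_step x :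
  \sum_o cross_weight o x * sqnorm (cross_step o) = (n%:R * r) ^+ 2.
Proof.
under eq_bigr => o _ do rewrite sqnorm_cross_step.
by rewrite -mulr_suml sum_cross_weight mul1r.
Qed.

Lemma polyfun_cross_weightM o d (g : 'rV[R]_n -> R) :
  polyfun d g -> polyfun d.+1 (cross_weight o * g).
Proof.
move=> Pg; have -> : cross_weight o * g = ((-1) ^+ o.2 / r / (2 * n%:R)) *:
    (affine_coord (Some o.1) * g) + (2 * n%:R)^-1 *: g.
  apply/funext => x; rewrite -[LHS]/(cross_weight o x * g x).
  rewrite -[RHS]/((-1) ^+ o.2 / r / (2 * n%:R) * (x ord0 o.1 * g x) + (2 * n%:R)^-1 * g x).
  by rewrite /cross_weight; ring.
by apply: polyfun_lin; [exact: polyfun_coordM|apply: polyfunS; exact: polyfunZ].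
Qed.

Lemma polyfun_approx_quadratic_modulus (K : set 'rV[R]_n) (f : 'rV[R]_n -> R) (e C : R) :
  0 < e -> 0 <= C -> (forall x, K x -> `|x| <= r) ->
  (forall x, K x -> forall y, `|f y - f x| <= e + C * sqdist x y) ->
  exists d p, polyfun d p /\ forall x, K x -> `|p x - f x| <= 2 * e.
Proof.
move=> e0 C0 Kr fle; pose V := (n%:R * r) ^+ 2.
have [N NV] : exists N : nat, C * V / e <= N.+1%:R.
  by exists (Num.truncn (C * V / e)); apply/ltW/truncnS_gt.
exists N.+1, (walk cross_weight cross_step N.+1%:R^-1 N.+1 f 0); split.
  by apply: polyfun_walk => o d g; exact: polyfun_cross_weightM.
move=> x Kx; apply: le_trans (walk_approx _ C0 (fun o => cross_weight_ge0 o (Kr x Kx))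
  (sum_cross_weight x) (mean_cross_step x) (var_cross_step x) (fle x Kx)) _.
  by rewrite mulfV.
by rewrite -/V [leRHS]mulr_natl mulr2n lerD2l mulrCA ler_pdivrMl// -ler_pdivrMr.
Qed.

End CrossPolytopeWalk.

Section Weierstrass.
Context {R : realType}.

Lemma compact_unif_continuous_at (V W : normedModType R) (f : V -> W) (K : set V) (e : R) :
  compact K -> 0 < e -> (forall x, K x -> {for x, continuous f}) ->
  exists2 d, 0 < d & forall x, K x -> forall y, `|y - x| < d -> `|f y - f x| <= e.
Proof.
move=> /compact_near_coveringP Kc e0 fc.
pose P (d : R) x := forall y, `|y - x| < d -> `|f y - f x| <= e.
have KP : \forall d \near (0 : R)^'+, K `<=` P d.
  apply: Kc => x Kx.
  have : \forall y \near x, `|f x - f y| <= e / 2.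
    by move: (fc _ Kx) => /cvgrPdist_le; apply; rewrite divr_gt0.
  move=> /nbhs_normP[d /= d0 fd].
  exists (ball_ Num.norm x (d / 2), [set t | t < d / 2]).
    split=> /=; last by apply: nbhs_right_lt; rewrite divr_gt0.
    by apply/nbhs_normP; exists (d / 2) => //=; rewrite divr_gt0.
  move=> [x' t] [/= xx' td] y yx'.
  rewrite (le_trans (ler_distD (f x) _ _))// [leRHS]splitr lerD//.
    rewrite distrC; apply: fd; rewrite /ball_/= [d]splitr.
    by rewrite (le_lt_trans (ler_distD x' _ _))// ltrD// distrC (lt_trans yx').
  by apply: fd; rewrite /ball_/= (lt_trans xx')// ltr_pdivrMr// ltr_pMr// ltr1n.
have [d [d0 dP]] : exists d : R, 0 < d /\ K `<=` P d.
  by near (0 : R)^'+ => d; exists d; split; [|near: d].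
by exists d => // x /dP.
Unshelve. all: end_near. Qed.

Lemma compact_quadratic_modulus n (K : set 'rV[R]_n) (f : 'rV[R]_n -> R) (M e : R) :
  compact K -> continuous f -> (forall x, `|f x| <= M) -> 0 < e ->
  exists2 C, 0 <= C & forall x, K x -> forall y, `|f y - f x| <= e + C * sqdist x y.
Proof.
move=> Kc fc fM e0; have M0 : 0 <= M by exact: le_trans (fM 0).
have [d d0 fd] := compact_unif_continuous_at Kc e0 (fun x _ => fc x).
have C0 : 0 <= 2 * M / d ^+ 2 by rewrite divr_ge0 ?sqr_ge0// mulr_ge0.
exists (2 * M / d ^+ 2) => // x Kx y; have [yd|yd] := ltP `|y - x| d.
  by rewrite (le_trans (fd _ Kx _ yd))// lerDl mulr_ge0// sqdist_ge0.
apply: (@le_trans _ _ (2 * M)).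
  by rewrite (le_trans (ler_normB _ _))// mulr_natl mulr2n lerD.
rewrite -[leLHS]add0r lerD ?(ltW e0)// mulrAC ler_pdivlMr ?exprn_gt0// ler_wpM2l ?mulr_ge0//.
by apply: le_trans (norm_le_sqnorm _); rewrite lerXn2r ?nnegrE// ltW.
Qed.

Lemma compact_norm_bound (V : normedModType R) (K : set V) : compact K ->
  exists2 r, 0 < r & forall x, K x -> `|x| <= r.
Proof.
move=> /compact_bounded/ex_strict_bound_gt0[r r0 Kr].
by exists r => // x /Kr/ltW.
Qed.

Lemma weierstrass_approximation n (K : set 'rV[R]_n) (u : 'rV[R]_n -> R) (e : R) : (0 < n)%N ->
  compact K -> {within K, continuous u} -> 0 < e ->
  exists d p, polyfun d p /\ forall x, K x -> `|p x - u x| <= e.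
Proof.
move=> n0 Kc uc e0; have e2 : 0 < e / 2 by rewrite divr_gt0.
have [r r0 Kr] := compact_norm_bound Kc.
have [M M0 uM] := compact_norm_bound (continuous_compact uc Kc).
have [|g [gu gc gM]] := continuous_bounded_extension pseudometric_normal
  (compact_closed (@norm_hausdorff _ _) Kc) M0 uc.
  by move=> x Kx; apply: uM; exists x.
have [C C0 gC] := compact_quadratic_modulus Kc gc gM e2.
have [d [p [Pp pg]]] := polyfun_approx_quadratic_modulus n0 r0 e2 C0 Kr gC.
exists d, p; split=> // x Kx; rewrite gu ?inE//.
by have := pg x Kx; rewrite mulrC divfK.
Qed.

End Weierstrass.

(** * Viscosity subsolutions *)

Section ViscositySubsolutions.
Context {R : realType} {n : nat}.
Implicit Types (F G : 'M[R]_n -> R) (Omega : set 'rV[R]_n) (u v phi : 'rV[R]_n -> R).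

Lemma open_B1 : open (@B1 R n).
Proof.
have -> : @B1 R n = sqdist 0 @^-1` [set y | y < 1].
  apply/funext => x; rewrite /B1 /= /sqdist subr0 -[enorm x]/(Num.sqrt (sqnorm x)).
  by rewrite -{1}(sqrtr1 R) ltr_sqrt.
by apply: open_comp => [x _|]; [exact: continuous_sqdist|exact: open_lt].
Qed.

Lemma visc_subsol_mono F G Omega u : open Omega ->
  (forall M, symmx M -> 0 <= F M -> 0 <= G M) ->
  visc_subsol F Omega u -> visc_subsol G Omega u.
Proof.
move=> Oo FG [uc usub]; split=> // phi x phi2 Ox touch; apply: FG; last exact: usub.
exact/hessian_sym/(C2_on_near Oo phi2 Ox).
Qed.

End ViscositySubsolutions.

Section LinearEquation.
Context {R : realType} {n : nat}.
Variables (A : 'M[R]_n) (Omega : set 'rV[R]_n).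
Hypotheses (As : symmx A) (Ap : psd A) (At : 0 < \tr A) (Oo : open Omega).
Implicit Types (u v psi : 'rV[R]_n -> R) (x z : 'rV[R]_n) (b c k e m : R).

Definition linear_op c (M : 'M[R]_n) : R := \tr (A *m M) - c.

Lemma linear_op_hessian_ge0 c psi x :
  (0 <= linear_op c (hessian psi x)) = (c <= tr_hessian A psi x).
Proof. exact: subr_ge0. Qed.

Lemma linear_subsol_comparison c u psi z b :
  visc_subsol (linear_op c) Omega u -> C2_on Omega psi -> cball z b `<=` Omega ->
  (forall x, sqdist z x < b -> tr_hessian A psi x < c) ->
  (forall x, sqdist z x = b -> u x <= psi x) ->
  forall x, cball z b x -> u x <= psi x.
Proof.
move=> [uc usub] psi2 BO Lpsi ule x xB; rewrite -subr_le0 -[u x - psi x]/((u - psi) x).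
apply: (cball_max_principle _ _ _ xB) => [y /BO Oy|p pb pmax|y yb].
- apply: continuousB; first exact: within_open_continuous uc Oy.
  by have [] := psi2 _ Oy.
- have Op : Omega p by apply: BO; exact: ltW.
  by have := usub psi p psi2 Op pmax; rewrite linear_op_hessian_ge0 leNgt Lpsi.
- by rewrite [leLHS]/(u y - psi y) subr_le0 ule.
Qed.

Lemma linear_subsol_majorant c k u z b e :
  visc_subsol (linear_op c) Omega u -> k < c -> 0 < b -> 0 < e -> cball z b `<=` Omega ->
  exists d h, [/\ polyfun d h, forall x, tr_hessian A h x = k,
    forall x, cball z b x -> u x <= h x & forall x, sqdist z x = b -> h x <= u x + e].
Proof.
move=> usub kc b0 e0 BO.
have e2 : 0 < e / 2 by rewrite divr_gt0.
have uB : {within cball z b, continuous u} by apply: continuous_subspaceW BO _; exact: usub.1.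
have [d [p [Pp pu]]] := weierstrass_approximation (trace_gt0_dim At) (@compact_cball _ _ z b) uB e2.
have [h [Ph hk hp]] :=
  polyfun_dirichlet z As Ap At b0 k (polyfunD Pp (polyfun_cst d (e / 2))).
have sphere x : sqdist z x = b -> u x <= h x <= u x + e.
  move=> xb; rewrite hp// -[(_ + _) x]/(p x + e / 2).
  have /pu : cball z b x by rewrite /cball/= xb.
  by rewrite ler_norml => /andP[? ?]; apply/andP; split; lra.
exists d.+2, h; split=> // [|x /sphere/andP[]//].
apply: (linear_subsol_comparison usub (polyfun_C2_on Ph) BO) => [x _|x /sphere/andP[]//].
by rewrite hk.
Qed.

Lemma linear_subsol_add_comparison c1 c2 k u v psi z b m :
  visc_subsol (linear_op c1) Omega u -> visc_subsol (linear_op c2) Omega v ->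
  k < c1 + c2 -> 0 < b -> C2_on Omega psi -> cball z b `<=` Omega ->
  (forall x, sqdist z x < b -> tr_hessian A psi x <= k) ->
  (forall x, sqdist z x = b -> u x + v x - psi x <= m) ->
  forall x, cball z b x -> u x + v x - psi x <= m.
Proof.
move=> usub vsub kc b0 psi2 BO Lpsi sphere x xB; apply/ler_addgt0Pr => e e0.
have e2 : 0 < e / 2 by rewrite divr_gt0.
pose g := (c1 + c2 - k) / 2; have g0 : 0 < g by rewrite divr_gt0// subr_gt0.
have lt_g c : c - g < c by rewrite gtrDl oppr_lt0.
have [du [hu [Pu Lu ule hule]]] := linear_subsol_majorant usub (lt_g c1) b0 e2 BO.
have [dv [hv [Pv Lv vle hvle]]] := linear_subsol_majorant vsub (lt_g c2) b0 e2 BO.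
have kE : k = (c1 - g) + (c2 - g) by rewrite /g; field.
have hu2 : C2_on Omega hu := polyfun_C2_on Pu.
have hv2 : C2_on Omega hv := polyfun_C2_on Pv.
have huv2 : C2_on Omega (hu + hv) by exact: C2_onD.
have : (hu + hv - psi) x <= m + e.
  apply: (tr_hessian_max_principle As Ap At b0 Oo (C2_onB Oo huv2 psi2) BO _ _ xB) => y yb.
    have Oy : Omega y by apply: BO; exact: ltW.
    rewrite (tr_hessianB _ (C2_on_near Oo huv2 Oy) (C2_on_near Oo psi2 Oy)).
    rewrite (tr_hessianD _ (C2_on_near Oo hu2 Oy) (C2_on_near Oo hv2 Oy)).
    by rewrite Lu Lv -kE subr_ge0 Lpsi.
  rewrite -[leLHS]/(hu y + hv y - psi y).
  by have := hule y yb; have := hvle y yb; have := sphere y yb; lra.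
rewrite -[leLHS]/(hu x + hv x - psi x).
by have := ule x xB; have := vle x xB; lra.
Qed.

(* Adding a small multiple of [|x - z|^2] to [phi] makes the local maximum of [w - phi] at [z]
   strict. *)
Lemma strict_touching w phi z k : C2_on Omega phi -> Omega z -> tr_hessian A phi z < k ->
  (\forall x \near z, w x - phi x <= w z - phi z) ->
  exists psi b d, [/\ C2_on Omega psi, 0 < b, 0 < d,
    forall x, cball z b x -> Omega x /\ tr_hessian A psi x < k &
    forall x, sqdist z x = b -> w x - psi x <= w z - psi z - d].
Proof.
move=> phi2 Oz Lphi touch.
pose eta := (k - tr_hessian A phi z) / (4 * \tr A).
have eta0 : 0 < eta by rewrite divr_gt0 ?mulr_gt0// subr_gt0.
have s2 : C2_on Omega (sqdist z) := polyfun_C2_on (polyfun_sqdist z).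
pose psi : 'rV[R]_n -> R := eta *: sqdist z + phi.
have psi2 : C2_on Omega psi by exact: C2_on_lin.
have Lpsi : tr_hessian A psi z < k.
  rewrite (tr_hessian_lin _ _ (C2_on_near Oo s2 Oz) (C2_on_near Oo phi2 Oz)) tr_hessian_sqdist.
  have -> : eta * (2 * \tr A) = (k - tr_hessian A phi z) / 2.
    by rewrite /eta; field; rewrite gt_eqF.
  by lra.
have [b b0 bP] : exists2 b, 0 < b & forall x, cball z b x -> [/\ Omega x,
    tr_hessian A psi x < k & w x - phi x <= w z - phi z].
  apply: cball_near; near=> x; split; near: x; first exact: open_nbhs_nbhs.
    by move: (tr_hessian_continuous (A := A) (psi2 _ Oz)) => /cvgr_lt; apply.
  exact: touch.
exists psi, b, (eta * b); split; [exact: psi2|exact: b0|exact: mulr_gt0| |].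
  by move=> x /bP[].
move=> x xb.
have [|_ _ wx] := bP x; first by rewrite /cball/= xb.
have psiE y : psi y = eta * sqdist z y + phi y by [].
by rewrite !psiE xb sqdistxx mulr0 add0r opprD addrCA [leRHS]addrC lerD2l.
Unshelve. all: end_near. Qed.

Lemma linear_subsolD c1 c2 u v :
  visc_subsol (linear_op c1) Omega u -> visc_subsol (linear_op c2) Omega v ->
  visc_subsol (linear_op (c1 + c2)) Omega (u + v).
Proof.
move=> usub vsub; split.
  by move=> x; apply: continuousD; [exact: usub.1|exact: vsub.1].
move=> phi z phi2 Oz touch; rewrite linear_op_hessian_ge0 leNgt; apply/negP => Lphi.
have [k [Lk kc]] : exists k, tr_hessian A phi z < k /\ k < c1 + c2.
  by exists ((tr_hessian A phi z + (c1 + c2)) / 2); rewrite midf_lt// midf_lt.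
have [psi [b [d [psi2 b0 d0 bP sphere]]]] := strict_touching phi2 Oz Lk touch.
have zB : cball z b z by rewrite /cball/= sqdistxx ltW.
have := linear_subsol_add_comparison usub vsub kc b0 psi2 (fun x xB => (bP x xB).1) _ sphere zB.
move=> /(_ (fun x xb => ltW (bP x (ltW xb)).2)).
by rewrite -[leRHS]/(u z + v z - psi z - d) lerDl oppr_ge0 leNgt d0.
Qed.

Lemma linear_subsolZ c a u : 0 < a ->
  visc_subsol (linear_op c) Omega u -> visc_subsol (linear_op (a * c)) Omega (a *: u).
Proof.
move=> a0 [uc usub]; split; first by move=> x; apply: continuousZl_tmp; exact: uc.
move=> phi z phi2 Oz touch; have := usub (a^-1 *: phi) z (C2_onZ _ Oo phi2) Oz.
rewrite !linear_op_hessian_ge0 (tr_hessianZ _ _ (C2_on_near Oo phi2 Oz)) ler_pdivlMl//.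
apply; apply: filterS touch => x.
have quotE y : u y - (a^-1 *: phi) y = a^-1 * ((a *: u) y - phi y).
  by rewrite -[(a^-1 *: phi) y]/(a^-1 * phi y) -[(a *: u) y]/(a * u y) mulrBr mulKf// gt_eqF.
by rewrite !quotE ler_pM2l// invr_gt0.
Qed.

Lemma linear_subsol_convex c theta u v : 0 < theta < 1 ->
  visc_subsol (linear_op c) Omega u -> visc_subsol (linear_op c) Omega v ->
  visc_subsol (linear_op c) Omega (theta *: u + (1 - theta) *: v).
Proof.
move=> /andP[t0 t1] usub vsub.
have -> : c = theta * c + (1 - theta) * c by rewrite -mulrDl addrC subrK mul1r.
by apply: linear_subsolD; apply: linear_subsolZ; rewrite ?subr_gt0.
Qed.

End LinearEquation.

Lemma visc_subsol_convex (R : realType) (n : nat) (F : 'M[R]_n -> R) (lam Lam : R)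
    (Omega : set 'rV[R]_n) u v theta : open Omega ->
  unif_elliptic F lam Lam -> {within [set M : 'M[R]_n | symmx M], continuous F} ->
  quasiconcave F -> visc_subsol F Omega u -> visc_subsol F Omega v -> 0 < theta < 1 ->
  visc_subsol F Omega (theta *: u + (1 - theta) *: v).
Proof.
move=> Oo Fell Fc Fq usub vsub t01; split.
  move=> x; apply: continuousD; apply: continuousZl_tmp; [exact: usub.1|exact: vsub.1].
move=> phi z phi2 Oz touch; have [n0|n0] := posnP n.
  have rV_eq (x y : 'rV[R]_n) : x = y by case: n0 x y => -> x y; rewrite !thinmx0.
  by apply: usub.2 => //; apply: (@nearW _ (nbhs z)) => x; rewrite (rV_eq x z).
rewrite leNgt; apply/negP => Fphi.
have Hs := hessian_sym (C2_on_near Oo phi2 Oz).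
have [A [c [As Ap At FA AHc]]] := elliptic_separation n0 Fell Fc Fq Hs Fphi.
have F_le_linear M : symmx M -> 0 <= F M -> 0 <= linear_op A c M.
  by move=> Ms FM; rewrite subr_ge0 FA.
have [_ linear_sub] := linear_subsol_convex As Ap At Oo t01
  (visc_subsol_mono Oo F_le_linear usub) (visc_subsol_mono Oo F_le_linear vsub).
have := linear_sub phi z phi2 Oz touch; rewrite linear_op_hessian_ge0.
by move=> /(lt_le_trans AHc); rewrite ltxx.
Qed.

Theorem theorem4p6 (R : realType) (n : nat) (F : 'M[R]_n -> R) (lam Lam : R)
  (u v : 'rV[R]_n -> R) (theta : R) :
  unif_elliptic F lam Lam ->
  {within [set M : 'M[R]_n | symmx M], continuous F} ->
  quasiconcave F ->
  visc_subsol F (@B1 R n) u -> visc_subsol F (@B1 R n) v ->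
  0 < theta < 1 ->
  visc_subsol F (@B1 R n) (fun x => theta * u x + (1 - theta) * v x).
Proof. exact: visc_subsol_convex (@open_B1 R n). Qed.
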